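(* Let $a\in\mathbb Z_+=\{0,1,2,\dots\}$, $b\in\mathbb R$, and let $\alpha$ be a multi-index with $|\alpha|\le\lfloor d/2\rfloor+1$. Then there exists a constant $N=N(d,a,b,\gamma,\nu)$ such that for all $\varepsilon\in(0,1)$ and all $s<t$, $$\int_{|\xi|\ge\varepsilon}|\hat q_{\alpha,a,b}(s,t,\xi)|^2\,d\xi\le N\,1_{a=b=0,\alpha\ne0}\Big(1+\varepsilon^{2(\gamma-|\alpha|)+d}+1_{2(\gamma-|\alpha|)=-d}\ln\varepsilon^{-1}\Big)$$ $$\qquad+N\big(1_{a\ne0}+1_{b\ne0}+1_{\alpha=0}\big)\Big(1+\varepsilon^{2(\gamma a+b-|\alpha|)+d}+1_{2(\gamma a+b-|\alpha|)=-d}\ln\varepsilon^{-1}\Big).$$ In particular, if either (i) $a=b=0$, $\alpha\neq0$ and $2(\gamma-|\alpha|)>-d$, or (ii) $2(\gamma a+b-|\alpha|)>-d$, then $$\sup_{s<t}\int_{\mathbb R^d}|\hat q_{\alpha,a,b}(s,t,\xi)|^2\,d\xi\le N(d,a,b,\gamma,\nu).$$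
   Context: Standing assumptions: $d\in\mathbb N$, $\gamma\in(0,\infty)$, $\nu>0$, and $\psi:\mathbb R\times\mathbb R^d\to\mathbb C$ is measurable with $\Re[\psi(t,\xi)]\le-\nu|\xi|^\gamma$ for all $(t,\xi)$ and $|D_\xi^\alpha\psi(t,\xi)|\le\nu^{-1}|\xi|^{\gamma-|\alpha|}$ for all $t\in\mathbb R$, $\xi\neq0$, $|\alpha|\le\lfloor d/2\rfloor+1$. For $s<t$, a multi-index $\alpha$, and $\xi\ne0$, $$\hat q_{\alpha,a,b}(s,t,\xi)=D_\xi^\alpha\Big[\big((t-s)\psi(t,(t-s)^{-1/\gamma}\xi)\big)^a|\xi|^b\exp\Big(\int_s^t\psi(r,(t-s)^{-1/\gamma}\xi)\,dr\Big)\Big].$$ $1_P$ equals $1$ if the condition $P$ holds and $0$ otherwise. (A zeroth power is $1$.) *)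

(* Defs.v *)
From HB Require Import structures.
From mathcomp Require Import all_boot all_order all_algebra.
From mathcomp Require Import complex.
From mathcomp Require Import all_classical all_reals all_analysis.

Set Implicit Arguments.
Unset Strict Implicit.
Unset Printing Implicit Defensive.

Import Order.TTheory GRing.Theory Num.Theory.
Import numFieldNormedType.Exports.

Local Open Scope classical_set_scope.
Local Open Scope ring_scope.

(* The product sigma-algebra on row vectors, generated by the coordinate maps;
   over [R] it is the Borel sigma-algebra of R^n. *)
Definition measure_rV_display : measure_display.
Proof. exact: default_measure_display. Qed.

Section measurable_rV.
Context {R : realType} (n : nat).

Let coors : 'I_n -> 'rV[R]_n -> R := fun i v => v ord0 i.

Let rV_set0 : g_sigma_preimage coors set0.
Proof. exact: sigma_algebra0. Qed.

Let rV_setC A : g_sigma_preimage coors A -> g_sigma_preimage coors (~` A).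
Proof. exact: sigma_algebraC. Qed.

Let rV_bigcup (F : _^nat) : (forall i, g_sigma_preimage coors (F i)) ->
  g_sigma_preimage coors (\bigcup_i (F i)).
Proof. exact: sigma_algebra_bigcup. Qed.

HB.instance Definition _ := @isMeasurable.Build measure_rV_display
  'rV[R]_n (g_sigma_preimage coors) rV_set0 rV_setC rV_bigcup.

End measurable_rV.

Section lebesgue_rV.
Context {R : realType}.

Lemma measurable_rV_coord n (i : 'I_n) :
  measurable_fun [set: 'rV[R]_n] (fun v : 'rV[R]_n => v ord0 i).
Proof.
move=> _ Y mY; rewrite setTI; apply: sub_sigma_algebra => /=.
rewrite -bigcup_seq/=; exists i => /=; first by rewrite mem_index_enum.
by exists Y => //; rewrite setTI.
Qed.

Lemma measurable_fun_rVP d (T : measurableType d) n (f : T -> 'rV[R]_n) :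
  measurable_fun [set: T] f <->
  forall i, measurable_fun [set: T] (fun x => f x ord0 i).
Proof.
split=> [mf i|mf].
  exact: (measurableT_comp (measurable_rV_coord i) mf).
pose coord i (v : 'rV[R]_n) := v ord0 i.
apply: (measurability
  (\big[setU/set0]_(i < n) preimage_set_system setT (coord i) measurable)) => //.
move=> _ [A + <-]; rewrite -bigcup_seq => -[i _ [B mB <-]] /=.
by rewrite !setTI -[X in measurable X]setTI; exact: mf.
Qed.

Definition rV_cons n (p : measurableTypeR R * 'rV[R]_n) : 'rV[R]_n.+1 :=
  \row_i oapp (p.2 ord0) p.1 (unlift ord0 i).

Definition rV_uncons n (v : 'rV[R]_n.+1) : measurableTypeR R * 'rV[R]_n :=
  (v ord0 ord0, \row_i v ord0 (lift ord0 i)).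

Lemma rV_cons0 n (p : measurableTypeR R * 'rV[R]_n) : rV_cons p ord0 ord0 = p.1.
Proof. by rewrite mxE unlift_none. Qed.

Lemma rV_consS n (p : measurableTypeR R * 'rV[R]_n) i :
  rV_cons p ord0 (lift ord0 i) = p.2 ord0 i.
Proof. by rewrite mxE liftK. Qed.

Lemma rV_consK n : cancel (@rV_cons n) (@rV_uncons n).
Proof.
move=> [x v]; rewrite /rV_uncons rV_cons0; congr pair => /=.
by apply/rowP => i; rewrite mxE rV_consS.
Qed.

Lemma measurable_rV_cons n : measurable_fun [set: measurableTypeR R * 'rV[R]_n] (@rV_cons n).
Proof.
apply/measurable_fun_rVP => i; case: (unliftP ord0 i) => [j|] ->.
  under eq_fun do rewrite rV_consS.
  exact: (measurableT_comp (measurable_rV_coord j) measurable_snd).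
by under eq_fun do rewrite rV_cons0; exact: measurable_fst.
Qed.

Lemma measurable_rV_uncons n : measurable_fun [set: 'rV[R]_n.+1] (@rV_uncons n).
Proof.
apply/measurable_fun_pairP; split; first exact: measurable_rV_coord.
apply/measurable_fun_rVP => i /=.
by under eq_fun do rewrite mxE; exact: measurable_rV_coord.
Qed.

Section lebesgue_rV_succ.
Variables (n : nat) (mu : {sigma_finite_measure set 'rV[R]_n -> \bar R}).

Definition lebesgue_rV_succ : set 'rV[R]_n.+1 -> \bar R :=
  pushforward (@lebesgue_measure R \x mu)%E (@rV_cons n).

Let lebesgue_rV_succ0 : lebesgue_rV_succ set0 = 0%E.
Proof. by rewrite /lebesgue_rV_succ /pushforward preimage_set0 measure0. Qed.

Let lebesgue_rV_succ_ge0 A : (0 <= lebesgue_rV_succ A)%E.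
Proof. by rewrite /lebesgue_rV_succ /pushforward; exact: measure_ge0. Qed.

Let lebesgue_rV_succ_sigma_additive : semi_sigma_additive lebesgue_rV_succ.
Proof.
move=> F mF tF mUF; rewrite /lebesgue_rV_succ /pushforward preimage_bigcup.
apply: measure_semi_sigma_additive.
- by move=> k; rewrite -[X in measurable X]setTI; exact: measurable_rV_cons.
- apply/trivIsetP => /= i j _ _ ij; rewrite -preimage_setI.
  by move/trivIsetP : tF => /(_ _ _ _ _ ij) ->//; rewrite preimage_set0.
- rewrite -preimage_bigcup -[X in measurable X]setTI.
  exact: measurable_rV_cons.
Qed.

HB.instance Definition _ := isMeasure.Build _ _ _ lebesgue_rV_succ
  lebesgue_rV_succ0 lebesgue_rV_succ_ge0 lebesgue_rV_succ_sigma_additive.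

Let lebesgue_rV_succ_sigma_finite : sigma_finite setT lebesgue_rV_succ.
Proof.
have /sigma_finiteP[F [FT ndF Foo]] := sigma_finiteT (@lebesgue_measure R).
have /sigma_finiteP[G [GT ndG Goo]] := sigma_finiteT mu.
exists (fun k => @rV_uncons n @^-1` (F k `*` G k)).
  rewrite -preimage_bigcup; apply/esym/seteqP; split=> // v _ /=.
  have [i _ Fi] : (\bigcup_i F i) (rV_uncons v).1 by rewrite -FT.
  have [j _ Gj] : (\bigcup_i G i) (rV_uncons v).2 by rewrite -GT.
  exists (maxn i j) => //; split.
    by apply: (subsetPset _ _ (ndF _ _ (leq_maxl i j))) Fi.
  by apply: (subsetPset _ _ (ndG _ _ (leq_maxr i j))) Gj.
move=> k; have [mF Fk] := Foo k; have [mG Gk] := Goo k; split.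
  rewrite -[X in measurable X]setTI; apply: measurable_rV_uncons => //.
  exact: measurableX.
rewrite /lebesgue_rV_succ /pushforward -comp_preimage.
rewrite (_ : _ \o _ = id); last by apply/funext => p /=; rewrite rV_consK.
by rewrite [ltLHS]product_measure1E// lte_mul_pinfty// ge0_fin_numE.
Qed.

HB.instance Definition _ := Measure_isSigmaFinite.Build _ _ _
  lebesgue_rV_succ lebesgue_rV_succ_sigma_finite.

End lebesgue_rV_succ.

Fixpoint lebesgue_rV n : {sigma_finite_measure set 'rV[R]_n -> \bar R} :=
  match n with
  | 0 => \d_(0 : 'rV[R]_0)
  | n'.+1 => lebesgue_rV_succ (lebesgue_rV n')
  end.

Lemma lebesgue_rV_box n (A : 'I_n -> set (measurableTypeR R)) :
  (forall i, measurable (A i)) ->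
  lebesgue_rV n [set v : 'rV[R]_n | forall i, A i (v ord0 i)] =
  (\prod_(i < n) lebesgue_measure (A i))%E.
Proof.
elim: n A => [|n IHn] A mA.
  rewrite big_ord0 /= (_ : [set _ | _] = setT) ?diracT//.
  by apply/seteqP; split => // v _ [].
rewrite big_ord_recl -IHn// /= /lebesgue_rV_succ /pushforward.
set B := [set v : 'rV[R]_n | forall i, A (lift ord0 i) (v ord0 i)].
have mB : measurable B.
  rewrite (_ : B = \bigcap_(i in [set: 'I_n])
      ((fun v : 'rV[R]_n => v ord0 i) @^-1` A (lift ord0 i))).
    apply: fin_bigcap_measurable => [|i _]; first exact: finite_finset.
    rewrite -[X in measurable X]setTI.
    exact: (@measurable_rV_coord n i measurableT _ (mA (lift ord0 i))).
  by apply/seteqP; split => v /= Av i; [move=> _|]; exact: Av.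
rewrite (_ : _ @^-1` _ = A ord0 `*` B) ?[LHS]product_measure1E//.
apply/seteqP; split => -[x v] /=.
  move=> Av; split; first by have := Av ord0; rewrite rV_cons0.
  by move=> i; have := Av (lift ord0 i); rewrite rV_consS.
move=> [Ax Bv] i.
by case: (unliftP ord0 i) => [j|] ->; rewrite ?rV_cons0 ?rV_consS//; exact: Bv.
Qed.

End lebesgue_rV.

Local Open Scope complex_scope.

Section symbol.
Context {R : realType} (d : nat).
Implicit Types (xi : 'rV[R]_d) (f : 'rV[R]_d -> R[i]) (i : 'I_d).

(* The norm that the library puts on ['rV[R]_d] is the sup norm. *)
Definition enorm xi : R := Num.sqrt (\sum_(i < d) xi ord0 i ^+ 2).

Definition expC (z : R[i]) : R[i] :=
  (expR (complex.Re z))%:C * (cos (complex.Im z) +i* sin (complex.Im z)).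

Definition Cintegral (s t : R) (f : R -> R[i]) : R[i] :=
  (\int[@lebesgue_measure R]_(r in `[s, t]) complex.Re (f r)) +i*
  (\int[@lebesgue_measure R]_(r in `[s, t]) complex.Im (f r)).

Definition has_partial i f xi : Prop :=
  derivable (fun x => complex.Re (f x)) xi (delta_mx ord0 i) /\
  derivable (fun x => complex.Im (f x)) xi (delta_mx ord0 i).

Definition partial i f xi : R[i] :=
  'D_(delta_mx ord0 i) (fun x => complex.Re (f x)) xi +i*
  'D_(delta_mx ord0 i) (fun x => complex.Im (f x)) xi.

Definition multi_index := {ffun 'I_d -> nat}.

Definition mi0 : multi_index := [ffun=> 0%N].

Definition mi_order (alpha : multi_index) : nat := (\sum_(i < d) alpha i)%N.

(* Each coordinate [i], repeated [alpha i] times, in increasing order. *)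
Definition mi_dirs (alpha : multi_index) : seq 'I_d :=
  flatten [seq nseq (alpha i) i | i <- enum 'I_d].

(* D^alpha f = D_1^(alpha_1) (... (D_d^(alpha_d) f)) *)
Definition Dmulti (alpha : multi_index) f : 'rV[R]_d -> R[i] :=
  foldr partial f (mi_dirs alpha).

(* The outermost of the [mi_order alpha] partial derivatives exists at [xi]
   (the inner ones are of the form [Dmulti beta f] with [beta <= alpha]). *)
Definition has_Dmulti (alpha : multi_index) f xi : Prop :=
  if mi_dirs alpha is i :: l then has_partial i (foldr partial f l) xi
  else True.

Definition max_order : nat := (d %/ 2).+1.

Record symbol_assumptions (gamma nu : R) (psi : R -> 'rV[R]_d -> R[i]) : Prop :=
  SymbolAssumptions {
    symbol_measurable :
      measurable_fun [set: R * 'rV[R]_d] (fun p => complex.Re (psi p.1 p.2)) /\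
      measurable_fun [set: R * 'rV[R]_d] (fun p => complex.Im (psi p.1 p.2)) ;
    symbol_elliptic : forall t xi,
      complex.Re (psi t xi) <= - nu * enorm xi `^ gamma ;
    symbol_derivable : forall t xi (alpha : multi_index),
      xi != 0 -> (mi_order alpha <= max_order)%N ->
      has_Dmulti alpha (psi t) xi ;
    symbol_bounded : forall t xi (alpha : multi_index),
      xi != 0 -> (mi_order alpha <= max_order)%N ->
      Normc.normc (Dmulti alpha (psi t) xi) <=
        nu^-1 * enorm xi `^ (gamma - (mi_order alpha)%:R)
  }.

Definition qhat (gamma : R) (psi : R -> 'rV[R]_d -> R[i])
    (alpha : multi_index) (a : nat) (b s t : R) : 'rV[R]_d -> R[i] :=
  Dmulti alpha (fun xi =>
    let eta := (t - s) `^ (- gamma^-1) *: xi in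
    ((t - s)%:C * psi t eta) ^+ a * (enorm xi `^ b)%:C *
    expC (Cintegral s t (fun r => psi r eta))).

Definition growth (p eps : R) : R :=
  1 + eps `^ (2 * p + d%:R) + (2 * p == - d%:R)%:R * ln eps^-1.

End symbol.

(* Main.v *)
Require Import Defs.
From mathcomp Require Import all_boot all_order all_algebra.
From mathcomp Require Import complex lra ring.
From mathcomp Require Import all_classical all_reals all_analysis measurable_realfun.
Import Order.TTheory GRing.Theory Num.Theory.
Import numFieldNormedType.Exports.
Local Open Scope classical_set_scope.
Local Open Scope ring_scope.
Local Open Scope complex_scope.

Set Implicit Arguments.
Unset Strict Implicit.
Unset Printing Implicit Defensive.

(** Call [f] of type [w] when its derivatives of order [k] are bounded by
    [w |xi| / |xi|^k] away from the origin. This class is stable under sums,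
    products, dilations and integration in time, and contains [|xi|^b]. By
    ellipticity [exp f] is of type [(1 + v)^n exp (- nu |xi|^gamma)] up to order
    [n] when [f] is the time integral of the symbol, of type
    [v = 2 nu^-1 |xi|^gamma]; the dilation by [(t - s)^(-1/gamma)] removes
    [t - s] from the bounds. Absorbing the polynomial factors in half of the
    exponential gives [|qhat|^2 <= K |xi|^(2 p) exp (- nu |xi|^gamma)] with
    [p = gamma a + b - |alpha|]; if [a = b = 0] and [alpha != 0], each term of
    the Leibniz expansion contains a derivative of the exponent, whence
    [p = gamma - |alpha|]. The radial majorant is integrated over the dyadic
    shells [2^k eps <= |xi| < 2^(k+1) eps], where the sum telescopes. *)

(** * Directional derivatives as one-variable derivatives *)

Section line_derivative.
Context {R : realType} {V : normedModType R}.
Implicit Types (f : V -> R) (x v : V).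

(** The two difference quotients are the same function of [h]. This transfers the one-variable chain
    rule and differentiation under the integral to directional derivatives. *)
Lemma is_derive_lineP f x v (c df : R) :
  is_derive (c *: v + x) v f df <->
  is_derive c 1 (fun h : R => f (h *: v + x)) df.
Proof.
have E : (fun h : R => h^-1 *: ((f \o shift (c *: v + x)) (h *: v) -
                                f (c *: v + x))) =
         (fun h : R => h^-1 *: (((fun h : R => f (h *: v + x)) \o shift c)
            (h *: (1 : R)) - f (c *: v + x))).
  apply/funext => h /=.
  by rewrite [h *: 1]mulr1 scalerDl addrA.
split=> -[]; rewrite /derivable /derive => D1 D2; split.
- by rewrite /derivable -E.
- by rewrite /derive -E.
- by rewrite /derivable E.
- by rewrite /derive E.
Qed.

Lemma is_derive_comp (g : R -> R) f x v (dg df : R) :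
  is_derive (f x) 1 g dg -> is_derive x v f df ->
  is_derive x v (fun y => g (f y)) (dg * df).
Proof.
have e : 0 *: v + x = x by rewrite scale0r add0r.
rewrite -{1 2}e => Dg Df; rewrite -e; apply/is_derive_lineP.
apply: (@is_derive1_comp _ g (fun h : R => f (h *: v + x))) => //.
exact/is_derive_lineP.
Qed.

Lemma is_derive_scale f x v (k df : R) :
  is_derive (k *: x) v f df -> is_derive x v (fun y => f (k *: y)) (k * df).
Proof.
have e : 0 *: v + k *: x = k *: x by rewrite scale0r add0r.
rewrite -{1}e => /is_derive_lineP Df.
have e' : 0 *: v + x = x by rewrite scale0r add0r.
rewrite -e'; apply/is_derive_lineP.
have -> : (fun h : R => f (k *: (h *: v + x))) =
          (fun h : R => f (h *: v + k *: x)) \o (fun h => k * h).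
  by apply/funext => h /=; rewrite scalerDr scalerA.
rewrite mulrC; apply: is_derive1_comp; first by rewrite mulr0.
rewrite -[X in is_derive _ _ _ X]mulr1.
exact: is_deriveZ.
Qed.

End line_derivative.

(** * The Euclidean norm *)

Section euclidean_norm.
Context {R : realType} (d : nat).
Implicit Types xi : 'rV[R]_d.

Lemma enorm_ge0 xi : 0 <= enorm xi.
Proof. exact: sqrtr_ge0. Qed.

Lemma enorm_sqr xi : enorm xi ^+ 2 = \sum_(i < d) xi ord0 i ^+ 2.
Proof. by rewrite sqr_sqrtr// sumr_ge0// => i _; exact: sqr_ge0. Qed.

Lemma enorm0 : enorm (0 : 'rV[R]_d) = 0.
Proof.
by rewrite /enorm big1 ?sqrtr0// => i _; rewrite mxE expr0n.
Qed.

Lemma enorm_gt0 xi : (0 < enorm xi) = (xi != 0).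
Proof.
have [->|x0] := eqVneq xi 0; first by rewrite enorm0 ltxx.
rewrite lt_neqAle enorm_ge0 andbT eq_sym.
apply: contra x0 => /eqP e; apply/eqP/rowP => i; rewrite mxE.
have := enorm_sqr xi; rewrite e expr0n/= => /esym/eqP.
rewrite psumr_eq0; last by move=> ? _; exact: sqr_ge0.
by move=> /allP /(_ i); rewrite mem_index_enum => /(_ isT); rewrite sqrf_eq0 => /eqP.
Qed.

Lemma enormZ (k : R) xi : 0 <= k -> enorm (k *: xi) = k * enorm xi.
Proof.
move=> k0; rewrite /enorm.
under eq_bigr do rewrite mxE exprMn.
by rewrite -mulr_sumr sqrtrM ?sqr_ge0// sqrtr_sqr ger0_norm.
Qed.

Lemma le_coord_enorm xi i : `|xi ord0 i| <= enorm xi.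
Proof.
rewrite -sqrtr_sqr ler_wsqrtr// (bigD1 i)//= lerDl.
by rewrite sumr_ge0// => j _; exact: sqr_ge0.
Qed.

Lemma near_neq0 xi : xi != 0 -> \forall y \near xi, y != 0.
Proof.
by move=> x0; apply: (@cvgr_neq0 R 'rV[R]_d _ (nbhs xi) _ id xi) => //; exact: cvg_id.
Qed.

End euclidean_norm.

(** * Partial derivatives of complex-valued functions *)

Section partial_calculus.
Context {R : realType} {d : nat}.
Implicit Types (xi : 'rV[R]_d) (f g : 'rV[R]_d -> R[i]) (i : 'I_d).

Definition is_partial i f xi (c : R[i]) : Prop :=
  is_derive xi (delta_mx ord0 i) (fun x => complex.Re (f x)) (complex.Re c) /\
  is_derive xi (delta_mx ord0 i) (fun x => complex.Im (f x)) (complex.Im c).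

Lemma is_partialW i f xi c : is_partial i f xi c -> has_partial i f xi.
Proof. by move=> [[D1 _] [D2 _]]. Qed.

Lemma is_partial_val i f xi c : is_partial i f xi c -> partial i f xi = c.
Proof.
by case: c => a b [[/= _ D1] [_ D2]]; rewrite /partial -D1 -D2.
Qed.

Lemma has_partialP i f xi :
  has_partial i f xi -> is_partial i f xi (partial i f xi).
Proof. by move=> [D1 D2]; split; exact: derivableP. Qed.

(** The complement of the origin is open, so agreement there already gives equal germs at [xi]. *)
Lemma is_partial_ext i f g xi c : xi != 0 ->
  (forall x, x != 0 -> f x = g x) -> is_partial i f xi c -> is_partial i g xi c.
Proof.
move=> x0 fg [D1 D2]; split.
- apply: near_eq_is_derive D1.
  by apply: filterS (near_neq0 x0) => y y0; rewrite fg.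
- apply: near_eq_is_derive D2.
  by apply: filterS (near_neq0 x0) => y y0; rewrite fg.
Qed.

Lemma is_partial_eq i f xi c c' :
  is_partial i f xi c -> c = c' -> is_partial i f xi c'.
Proof. by move=> + <-. Qed.

Lemma is_partial_cst i (c : R[i]) xi : is_partial i (cst c) xi 0.
Proof. by split; exact: is_derive_cst. Qed.

Lemma is_partialD i f g xi c c' : is_partial i f xi c -> is_partial i g xi c' ->
  is_partial i (fun x => f x + g x) xi (c + c').
Proof.
move=> [F1 F2] [G1 G2]; split.
- rewrite (_ : (fun _ => _) = (fun x => complex.Re (f x)) + (fun x => complex.Re (g x))).
    by rewrite raddfD; exact: is_deriveD.
  by apply/funext => x; rewrite raddfD.
- rewrite (_ : (fun _ => _) = (fun x => complex.Im (f x)) + (fun x => complex.Im (g x))).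
    by rewrite raddfD; exact: is_deriveD.
  by apply/funext => x; rewrite raddfD.
Qed.

Lemma Re_addc (z w : R[i]) : complex.Re (z + w) = complex.Re z + complex.Re w.
Proof. by case: z w => [? ?] [? ?]. Qed.

Lemma Im_addc (z w : R[i]) : complex.Im (z + w) = complex.Im z + complex.Im w.
Proof. by case: z w => [? ?] [? ?]. Qed.

Lemma Re_mulc (z w : R[i]) :
  complex.Re (z * w) = complex.Re z * complex.Re w - complex.Im z * complex.Im w.
Proof. by case: z w => [? ?] [? ?]. Qed.

Lemma Im_mulc (z w : R[i]) :
  complex.Im (z * w) = complex.Re z * complex.Im w + complex.Im z * complex.Re w.
Proof. by case: z w => [? ?] [? ?]. Qed.

Lemma is_partialM i f g xi c c' : is_partial i f xi c -> is_partial i g xi c' ->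
  is_partial i (fun x => f x * g x) xi (c * g xi + f xi * c').
Proof.
move=> [F1 F2] [G1 G2]; split.
- rewrite (_ : (fun _ => _) =
    (fun x => complex.Re (f x)) * (fun x => complex.Re (g x)) -
    (fun x => complex.Im (f x)) * (fun x => complex.Im (g x))); last first.
    by apply/funext => x; rewrite Re_mulc.
  apply: is_derive_eq; rewrite Re_addc !Re_mulc /= /GRing.scale /=; ring.
- rewrite (_ : (fun _ => _) =
    (fun x => complex.Re (f x)) * (fun x => complex.Im (g x)) +
    (fun x => complex.Im (f x)) * (fun x => complex.Re (g x))); last first.
    by apply/funext => x; rewrite Im_mulc.
  apply: is_derive_eq; rewrite Im_addc !Im_mulc /= /GRing.scale /=; ring.
Qed.

Lemma is_partial_expC i f xi c : is_partial i f xi c ->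
  is_partial i (fun x => expC (f x)) xi (c * expC (f xi)).
Proof.
move=> [F1 F2].
have E : is_derive xi (delta_mx ord0 i) (fun x => expR (complex.Re (f x)))
     (expR (complex.Re (f xi)) * complex.Re c) by exact: is_derive_comp.
have C : is_derive xi (delta_mx ord0 i) (fun x => cos (complex.Im (f x)))
     (- sin (complex.Im (f xi)) * complex.Im c) by exact: is_derive_comp.
have S : is_derive xi (delta_mx ord0 i) (fun x => sin (complex.Im (f x)))
     (cos (complex.Im (f xi)) * complex.Im c) by exact: is_derive_comp.
split.
- rewrite (_ : (fun _ => _) =
    (fun x => expR (complex.Re (f x))) * (fun x => cos (complex.Im (f x)))); last first.
    by apply/funext => x; rewrite /expC Re_mulc /= mul0r subr0.
  apply: is_derive_eq; rewrite /expC !Re_mulc !Im_mulc /= /GRing.scale /=; ring.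
- rewrite (_ : (fun _ => _) =
    (fun x => expR (complex.Re (f x))) * (fun x => sin (complex.Im (f x)))); last first.
    by apply/funext => x; rewrite /expC Im_mulc /= mul0r addr0.
  apply: is_derive_eq; rewrite /expC Im_mulc Re_mulc Im_mulc /= /GRing.scale /=; ring.
Qed.

Lemma is_partial_scale i f xi (k : R) c : is_partial i f (k *: xi) c ->
  is_partial i (fun x => f (k *: x)) xi (k%:C * c).
Proof.
move=> [F1 F2]; split.
- rewrite Re_mulc /= mul0r subr0.
  exact: (@is_derive_scale _ _ (fun x => complex.Re (f x))).
- rewrite Im_mulc /= mul0r addr0.
  exact: (@is_derive_scale _ _ (fun x => complex.Im (f x))).
Qed.

Lemma is_partial_real i (f : 'rV[R]_d -> R) xi c :
  is_derive xi (delta_mx ord0 i) f c ->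
  is_partial i (fun x => (f x)%:C) xi c%:C.
Proof. by move=> D; split => //=; exact: is_derive_cst. Qed.

Lemma is_derive_coord (i j : 'I_d) xi :
  is_derive xi (delta_mx ord0 i) (fun x : 'rV[R]_d => x ord0 j) (i == j)%:R.
Proof.
have e : 0 *: delta_mx ord0 i + xi = xi by rewrite scale0r add0r.
rewrite -{1}e; apply/is_derive_lineP.
rewrite (_ : (fun _ => _) = (fun h : R => h * (i == j)%:R + xi ord0 j)).
  rewrite (_ : (fun _ => _) = ((i == j)%:R \*: id) + cst (xi ord0 j)).
    by apply: is_derive_eq; rewrite addr0 [_ *: _]mulr1.
  by apply/funext => h; rewrite /= mulrC.
by apply/funext => h; rewrite !mxE /= eq_sym.
Qed.

(** Off the origin, [|x|^b] is the power [b / 2] of the positive polynomial [q x = |x|^2], and the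
    chain rule applies. *)
Lemma is_derive_enorm_powR i (b : R) xi : xi != 0 ->
  is_derive xi (delta_mx ord0 i) (fun x : 'rV[R]_d => enorm x `^ b)
    (b * xi ord0 i * enorm xi `^ (b - 2)).
Proof.
move=> x0; have r0 : 0 < enorm xi by rewrite enorm_gt0.
pose q (x : 'rV[R]_d) := \sum_(j < d) x ord0 j ^+ 2.
have q0 : 0 < q xi by rewrite /q -enorm_sqr exprn_gt0.
have Dq : is_derive xi (delta_mx ord0 i) q (2 * xi ord0 i).
  rewrite (_ : q = \sum_(j < d) (fun x : 'rV[R]_d => x ord0 j) ^+ 2); last first.
    by apply/funext => x; rewrite /q fct_sumE.
  apply: is_derive_eq.
    by apply: is_derive_sum => j; apply: is_deriveX; exact: is_derive_coord.
  rewrite (bigD1 i)//= eqxx big1 ?addr0; last first.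
    by move=> j /negbTE ji; rewrite eq_sym ji scaler0.
  by rewrite [_ *: _]mulr1 expr1.
have E (x : 'rV[R]_d) c : 0 <= q x -> enorm x `^ c = q x `^ (c / 2).
  by move=> ?; rewrite /enorm -/(q x) -powR12_sqrt// -powRrM [2^-1 * c]mulrC.
have := @is_derive_comp _ _ (fun y => y `^ (b/2)) q xi (delta_mx ord0 i) _ _
   (is_derive1_powR (b/2) q0) Dq.
rewrite (_ : (fun y => _) = (fun x : 'rV[R]_d => enorm x `^ b)); last first.
  apply/funext => y; rewrite E//.
  by rewrite /q sumr_ge0// => j _; exact: sqr_ge0.
move=> D; apply: is_derive_eq; rewrite E ?(ltW q0)//.
rewrite (_ : (b - 2) / 2 = b / 2 - 1) ?mulrBl ?divff//.
by field.
Qed.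

End partial_calculus.

(** * The complex modulus *)

Section normc_lemmas.
Context {R : realType}.
Implicit Types z w : R[i].

Lemma normcD z w : Normc.normc (z + w) <= Normc.normc z + Normc.normc w.
Proof. exact: (@le_normcD _ z w). Qed.

Lemma normc_ge0 z : 0 <= Normc.normc z.
Proof. by case: z => a b; exact: sqrtr_ge0. Qed.

Lemma normc_real (x : R) : Normc.normc x%:C = `|x|.
Proof. by rewrite /= expr0n/= addr0 sqrtr_sqr. Qed.

Lemma normr_Re z : `|complex.Re z| <= Normc.normc z.
Proof.
by case: z => a b /=; rewrite -sqrtr_sqr ler_wsqrtr// lerDl sqr_ge0.
Qed.

Lemma normr_Im z : `|complex.Im z| <= Normc.normc z.
Proof.
by case: z => a b /=; rewrite -sqrtr_sqr ler_wsqrtr// lerDr sqr_ge0.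
Qed.

Lemma normc_le_ReIm z : Normc.normc z <= `|complex.Re z| + `|complex.Im z|.
Proof.
case: z => a b /=; rewrite -[leRHS]ger0_norm ?addr_ge0// -sqrtr_sqr.
rewrite ler_wsqrtr// sqrrD !real_normK ?num_real// lerD2r lerDl.
by rewrite mulrn_wge0// mulr_ge0.
Qed.

Lemma normc_expC z : Normc.normc (expC z) = expR (complex.Re z).
Proof.
by rewrite Normc.normcM normc_real ger0_norm ?expR_ge0//= cos2Dsin2 sqrtr1 mulr1.
Qed.

End normc_lemmas.

(** * Symbol classes and their closure properties *)

Section symbol_class.
Context {R : realType} {d : nat}.
Implicit Types (xi : 'rV[R]_d) (f g : 'rV[R]_d -> R[i]) (i : 'I_d)
  (l : seq 'I_d) (w v : R -> R).

(* The derivatives are taken from the head of [l] on, so that [foldr partial f]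
   corresponds to [rev l]; every subsequence of [l] is covered, which is what
   the Leibniz rule needs. *)
Fixpoint symb l w f : Prop :=
  if l is i :: l' then
    [/\ forall xi, xi != 0 -> has_partial i f xi,
        symb l' w f & symb l' (fun r => w r / r) (partial i f)]
  else forall xi, xi != 0 -> Normc.normc (f xi) <= w (enorm xi).

Lemma symb_ext l w f g : (forall xi, xi != 0 -> f xi = g xi) ->
  symb l w f -> symb l w g.
Proof.
elim: l w f g => [|i l IH] w f g fg /=.
  by move=> Hf xi x0; rewrite -fg//; exact: Hf.
move=> [H1 H2 H3].
have P xi : xi != 0 -> is_partial i g xi (partial i f xi).
  by move=> x0; apply: is_partial_ext fg _ => //; exact: has_partialP (H1 _ x0).
split.
- by move=> xi /P /is_partialW.
- exact: IH fg H2.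
- by apply: IH H3 => xi x0; rewrite (is_partial_val (P _ x0)).
Qed.

Lemma symb_le l w v f : (forall r, 0 < r -> w r <= v r) ->
  symb l w f -> symb l v f.
Proof.
elim: l w v f => [|i l IH] w v f wv /=.
  by move=> H xi x0; rewrite (le_trans (H _ x0))// wv// enorm_gt0.
move=> [H1 H2 H3]; split => //; first exact: IH H2.
by apply: IH H3 => r r0; rewrite ler_pM2r ?invr_gt0// wv.
Qed.

(** Main way into the class: it suffices to exhibit a formula [g] for the derivative off the origin
    and to bound [f] and [g] along the shorter list. *)
Lemma symb_cons l i w f g :
  (forall xi, xi != 0 -> is_partial i f xi (g xi)) ->
  symb l w f -> symb l (fun r => w r / r) g -> symb (i :: l) w f.
Proof.
move=> P H1 H2; split => //; first by move=> xi /P/is_partialW.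
by apply: symb_ext H2 => xi x0; rewrite (is_partial_val (P _ x0)).
Qed.

(** Each derivative divides the weight by [r]. The list is reversed because [foldr] applies its last
    element first, while [symb] consumes the head first. *)
Lemma symb_bound l w f : symb l w f -> forall xi, xi != 0 ->
  Normc.normc (foldr (@partial R d) f (rev l) xi) <=
    w (enorm xi) / enorm xi ^+ size l.
Proof.
elim: l w f => [|i l IH] w f /=.
  by move=> H xi x0; rewrite expr0 divr1; exact: H.
move=> [_ _ /IH H] xi x0; have := H _ x0.
by rewrite rev_cons foldr_rcons exprS invfM mulrA.
Qed.

Lemma symb_bound0 l w f : symb l w f -> forall xi, xi != 0 ->
  Normc.normc (f xi) <= w (enorm xi).
Proof. by elim: l w f => [|i l IH] w f //= [_ /IH H _]. Qed.

Lemma symbD l w v f g : symb l w f -> symb l v g ->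
  symb l (fun r => w r + v r) (fun x => f x + g x).
Proof.
elim: l w v f g => [|i l IH] w v f g /=.
  by move=> Hf Hg xi x0; rewrite (le_trans (normcD _ _))// lerD ?Hf ?Hg.
move=> [F1 F2 F3] [G1 G2 G3].
apply: (@symb_cons _ _ _ _ (fun x => partial i f x + partial i g x)).
- by move=> xi x0; apply: is_partialD; apply: has_partialP; [exact: F1|exact: G1].
- exact: IH.
- by apply: symb_le (IH _ _ _ _ F3 G3) => r r0; rewrite mulrDl.
Qed.

Lemma symb_cst l (c : R[i]) : symb l (fun=> Normc.normc c) (cst c).
Proof.
elim: l c => [|i l IH] c //=.
apply: (@symb_cons _ _ _ _ (cst 0)); first by move=> xi _; exact: is_partial_cst.
  exact: IH.
apply: symb_le (IH _) => r r0.
by rewrite Normc.normc0 divr_ge0 ?normc_ge0// ltW.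
Qed.

(** Leibniz rule: both terms of the derivative of a product have weight [w v / r], so every
    differentiation at most doubles the constant. *)
Lemma symbM l w v f g : (forall r, 0 < r -> 0 <= w r) -> (forall r, 0 < r -> 0 <= v r) ->
  symb l w f -> symb l v g ->
  symb l (fun r => 2 ^+ size l * w r * v r) (fun x => f x * g x).
Proof.
elim: l w v f g => [|i l IH] w v f g w0 v0 /=.
  move=> Hf Hg xi x0; rewrite expr0 mul1r Normc.normcM.
  by rewrite ler_pM ?normc_ge0 ?Hf ?Hg.
move=> [F1 F2 F3] [G1 G2 G3].
have dw0 r : 0 < r -> 0 <= w r / r by move=> r0; rewrite divr_ge0 ?w0// ltW.
have dv0 r : 0 < r -> 0 <= v r / r by move=> r0; rewrite divr_ge0 ?v0// ltW.
apply: (@symb_cons _ _ _ _ (fun x => partial i f x * g x + f x * partial i g x)).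
- move=> xi x0; apply: is_partialM; apply: has_partialP; [exact: F1|exact: G1].
- apply: symb_le (IH _ _ _ _ w0 v0 F2 G2) => r r0.
  by rewrite ler_wpM2r ?v0// ler_wpM2r ?w0// exprS ler_peMl ?exprn_ge0 ?ler1n.
- apply: symb_le (symbD (IH _ _ _ _ dw0 v0 F3 G2) (IH _ _ _ _ w0 dv0 F2 G3)).
  move=> r r0; rewrite le_eqVlt; apply/orP; left; apply/eqP.
  by rewrite exprS; ring.
Qed.

(** A constant factor is never differentiated, so the loss [2 ^+ size l] of [symbM] is avoided; the
    exact weight in [symb_scale] relies on this. *)
Lemma symbZ l w f (c : R[i]) : symb l w f ->
  symb l (fun r => Normc.normc c * w r) (fun x => c * f x).
Proof.
elim: l w f => [|i l IH] w f /=.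
  by move=> H xi x0; rewrite Normc.normcM ler_wpM2l ?normc_ge0 ?H.
move=> [H1 H2 H3]; apply: (@symb_cons _ _ _ _ (fun x => c * partial i f x)).
- move=> xi x0; apply: is_partial_eq.
    apply: is_partialM; first exact: is_partial_cst.
    exact: has_partialP (H1 _ x0).
  by rewrite mul0r add0r.
- exact: IH.
- by apply: symb_le (IH _ _ H3) => r r0; rewrite mulrA.
Qed.

(** The factor [k] of the chain rule turns [w (k r) / (k r)] into [w (k r) / r]: the class is scale
    invariant. *)
Lemma symb_scale l w f (k : R) : 0 < k -> symb l w f ->
  symb l (fun r => w (k * r)) (fun x => f (k *: x)).
Proof.
move=> k0; have kx (xi : 'rV[R]_d) : xi != 0 -> k *: xi != 0.
  by move=> x0; rewrite scaler_eq0 gt_eqF.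
elim: l w f => [|i l IH] w f /=.
  by move=> H xi x0; have := H _ (kx _ x0); rewrite enormZ// ltW.
move=> [H1 H2 H3].
apply: (@symb_cons _ _ _ _ (fun x => k%:C * partial i f (k *: x))).
- by move=> xi x0; apply: is_partial_scale; exact: has_partialP (H1 _ (kx _ x0)).
- exact: IH.
- apply: symb_le (symbZ k%:C (IH _ _ H3)) => r r0.
  rewrite normc_real gtr0_norm// le_eqVlt; apply/orP; left; apply/eqP.
  by field; rewrite !gt_eqF.
Qed.

End symbol_class.

(** * Coordinates, powers and exponentials as symbols *)

Section symbol_examples.
Context {R : realType} {d : nat}.
Implicit Types (xi : 'rV[R]_d) (f g : 'rV[R]_d -> R[i]) (i : 'I_d)
  (l : seq 'I_d) (w v e : R -> R).

Lemma symb_coord l i : symb l id (fun x : 'rV[R]_d => (x ord0 i)%:C).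
Proof.
elim: l => [|j l IH].
  by move=> xi x0; rewrite normc_real le_coord_enorm.
apply: (symb_cons (g := cst (j == i)%:R%:C)) => //.
  by move=> xi x0; apply: is_partial_real; exact: is_derive_coord.
apply: symb_le (symb_cst l _) => r r0.
by rewrite normc_real divff ?(lt0r_neq0 r0)// normr_nat lern1 leq_b1.
Qed.

Lemma powRB1 (r b : R) : 0 < r -> r `^ (b - 1) = r `^ b / r.
Proof. by move=> r0; rewrite powRB ?(gt_eqF r0) ?implybT// powRr1// ltW. Qed.

(** Induction on [n] for all [b] at once: the derivative [b x_i |x|^(b - 2)] calls for the bound at
    [b - 2], and the product with [x_i], of weight [r], has order [b - 1]. *)
Lemma symb_enorm_powR n (b : R) : exists2 C, 0 <= C &
  forall l, size l = n ->
    symb l (fun r => C * r `^ b) (fun x : 'rV[R]_d => (enorm x `^ b)%:C).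
Proof.
elim: n b => [|n IH] b.
  exists 1 => // l /size0nil -> xi x0.
  by rewrite mul1r normc_real ger0_norm ?powR_ge0.
have [C1 C10 H1] := IH b; have [C2 C20 H2] := IH (b - 2).
exists (C1 + `|b| * 2 ^+ n * C2) => [|[//|i l] [ln]].
  by rewrite addr_ge0// !mulr_ge0.
have K0 : 0 <= `|b| * 2 ^+ n * C2 by rewrite !mulr_ge0.
apply: (symb_cons (g := fun x : 'rV[R]_d =>
  b%:C * ((x ord0 i)%:C * (enorm x `^ (b - 2))%:C))).
- move=> xi x0; apply: is_partial_eq.
    by apply: is_partial_real; exact: is_derive_enorm_powR.
  by rewrite -!rmorphM mulrA.
- by apply: symb_le (H1 _ ln) => r r0; rewrite ler_wpM2r ?powR_ge0// lerDl.
- have := symbM (w := id) (v := fun r => C2 * r `^ (b - 2)) _ _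
    (symb_coord l i) (H2 _ ln).
  rewrite ln => /(_ _ _)/(symbZ b%:C) H; apply: symb_le (H _ _) => [r r0|r /ltW//|r r0].
    rewrite normc_real (_ : b - 2 = b - 1 - 1); last by ring.
    rewrite !powRB1// mulrDl mulrDl.
    have -> : `|b| * (2 ^+ n * r * (C2 * (r `^ b / r / r))) =
      `|b| * 2 ^+ n * C2 * r `^ b / r by field; rewrite gt_eqF.
    by rewrite lerDr divr_ge0 ?mulr_ge0 ?powR_ge0// ltW.
  by rewrite mulr_ge0 ?powR_ge0.
Qed.

(** The constant is chosen before [l], [w] and [f]; this order of quantifiers makes the final bound
    uniform in the symbol and in [s < t]. *)
Lemma symbX n a : exists2 C : R, 0 <= C &
  forall l w f, size l = n -> (forall r, 0 < r -> 0 <= w r) -> symb l w f ->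
    symb l (fun r => C * w r ^+ a) (fun x => f x ^+ a).
Proof.
elim: a => [|a [C C0 IH]].
  exists 1 => // l w f ln w0 _.
  apply: symb_le (symb_cst l 1) => r r0.
  by rewrite Normc.normc1 expr0 mulr1.
exists (2 ^+ n * C); first by rewrite mulr_ge0.
move=> l w f ln w0 Sf.
have H := symbM w0 (v := fun r => C * w r ^+ a) _ Sf (IH _ _ _ ln w0 Sf).
apply: symb_le (symb_ext _ (H _)) => [r r0|xi _|r r0]; last 2 first.
- by rewrite exprS.
- by rewrite mulr_ge0 ?exprn_ge0 ?w0.
- by rewrite ln exprS le_eqVlt; apply/orP; left; apply/eqP; ring.
Qed.

(** Every derivative of [exp f] produces a factor of weight [v / r]. The base [1 + v] dominates both
    [1] and [v], so terms with fewer factors are covered too, and [e] bounds [|exp f| = exp (Re f)]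
    throughout. *)
Lemma symb_expC n : exists2 C : R, 0 <= C &
  forall l v e f, size l = n ->
    (forall r, 0 < r -> 0 <= v r) -> (forall r, 0 < r -> 0 <= e r) ->
    (forall xi, xi != 0 -> expR (complex.Re (f xi)) <= e (enorm xi)) ->
    symb l v f ->
    symb l (fun r => C * (1 + v r) ^+ n * e r) (fun x => expC (f x)).
Proof.
elim: n => [|n [C C0 IH]].
  exists 1 => // l v e f /size0nil -> v0 e0 fe _ xi x0.
  by rewrite normc_expC expr0 !mul1r fe.
exists (2 ^+ n * C) => [|[//|i l] v e f [ln] v0 e0 fe]; first by rewrite mulr_ge0.
move=> /= [S1 S2 S3].
have He := IH _ _ _ _ ln v0 e0 fe S2.
have We r : 0 < r -> 0 <= C * (1 + v r) ^+ n * e r.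
  by move=> r0; rewrite !mulr_ge0 ?exprn_ge0 ?addr_ge0 ?v0 ?e0.
apply: (symb_cons (g := fun x => partial i f x * expC (f x))).
- by move=> xi x0; apply: is_partial_expC; exact: has_partialP (S1 _ x0).
- apply: symb_le He => r r0.
  have v1 : 0 <= (1 + v r) by rewrite addr_ge0 ?v0.
  rewrite ler_wpM2r ?e0//.
  have -> : 2 ^+ n * C * (1 + v r) ^+ n.+1 =
     (2 ^+ n * (1 + v r)) * (C * (1 + v r) ^+ n) by rewrite exprS; ring.
  rewrite ler_peMl ?mulr_ge0 ?exprn_ge0//.
  by rewrite mulr_ege1 ?exprn_ege1 ?ler1n// lerDl v0.
- have Wv r : 0 < r -> 0 <= v r / r by move=> r0; rewrite divr_ge0 ?v0 ?ltW.
  apply: symb_le (symbM Wv We S3 He) => r r0.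
  have v1 : 0 <= (1 + v r) by rewrite addr_ge0 ?v0.
  have -> : 2 ^+ size l * (v r / r) * (C * (1 + v r) ^+ n * e r) =
    v r * (2 ^+ n * C * (1 + v r) ^+ n * e r / r) by rewrite ln; ring.
  have -> : 2 ^+ n * C * (1 + v r) ^+ n.+1 * e r / r =
     (1 + v r) * (2 ^+ n * C * (1 + v r) ^+ n * e r / r) by rewrite exprS; ring.
  have W0 : 0 <= 2 ^+ n * C * (1 + v r) ^+ n * e r.
    by apply: mulr_ge0; [rewrite !mulr_ge0// exprn_ge0|exact: e0].
  by rewrite ler_wpM2r ?lerDr// divr_ge0 ?(ltW r0).
Qed.

(** Once a derivative has been taken, [f' exp f] carries a genuine factor [v / r]. It is kept apart
    from the powers of [1 + v] because it is small near the origin; this is the gain in the case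
    [a = b = 0]. *)
Lemma symb_partial_expC n : exists2 C : R, 0 <= C &
  forall l i v e f, size l = n ->
    (forall r, 0 < r -> 0 <= v r) -> (forall r, 0 < r -> 0 <= e r) ->
    (forall xi, xi != 0 -> expR (complex.Re (f xi)) <= e (enorm xi)) ->
    symb (i :: l) v f ->
    symb l (fun r => C * (v r / r) * ((1 + v r) ^+ n * e r))
      (partial i (fun x => expC (f x))).
Proof.
have [C C0 H] := symb_expC n; exists (2 ^+ n * C); first by rewrite mulr_ge0.
move=> l i v e f ln v0 e0 fe [S1 S2 S3].
have He := H _ _ _ _ ln v0 e0 fe S2.
have We r : 0 < r -> 0 <= C * (1 + v r) ^+ n * e r.
  by move=> r0; rewrite !mulr_ge0 ?exprn_ge0 ?addr_ge0 ?v0 ?e0.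
have Wv r : 0 < r -> 0 <= v r / r by move=> r0; rewrite divr_ge0 ?v0 ?ltW.
apply: symb_le (symb_ext _ (symbM Wv We S3 He)) => [r r0|xi x0].
  by rewrite ln le_eqVlt; apply/orP; left; apply/eqP; ring.
have P := is_partial_expC (has_partialP (S1 _ x0)).
by rewrite (is_partial_val P).
Qed.

End symbol_examples.

(** * Time integrals of bounded functions *)

Section bounded_integral.
Context {R : realType}.
Local Notation mu := (@lebesgue_measure R).

Lemma integrable_bounded_itv (g : R -> R) (s t M : R) :
  measurable_fun [set: R] g -> (forall r, `|g r| <= M) ->
  mu.-integrable `[s, t] (EFin \o g).
Proof.
move=> mg gM; apply: measurable_bounded_integrable => //.
- by rewrite /= lebesgue_measure_itv/=; case: ifP => _; rewrite ?ltry// -EFinD ltry.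
- exact: measurable_funTS.
- exists M; split; first exact: num_real.
  by move=> y My r _; rewrite /= (le_trans (gM _))// ltW.
Qed.

Lemma Rintegral_itv_cst (s t c : R) : s < t ->
  \int[mu]_(r in `[s, t]) c = (t - s) * c.
Proof.
move=> st; rewrite Rintegral_cst//= lebesgue_measure_itv/= lte_fin st.
by rewrite -EFinD/= mulrC.
Qed.

Lemma normr_Rintegral_itv (g : R -> R) (s t M : R) : s < t ->
  measurable_fun [set: R] g -> (forall r, `|g r| <= M) ->
  `|\int[mu]_(r in `[s, t]) g r| <= (t - s) * M.
Proof.
move=> st mg gM; rewrite -Rintegral_itv_cst//.
have ig := integrable_bounded_itv s t mg gM.
apply: le_trans (le_normr_Rintegral _ ig) _ => //.
apply: le_Rintegral => //.
- apply: (@integrable_bounded_itv (fun r => `|g r|) _ _ M).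
    exact: measurableT_comp.
  by move=> r; rewrite normr_id.
- by apply: (@integrable_bounded_itv (fun=> M) _ _ `|M|).
Qed.

End bounded_integral.

(** * Differentiation under the time integral *)

Section symbol_integral.
Context {R : realType} {d : nat}.
Implicit Types (xi : 'rV[R]_d) (f g : 'rV[R]_d -> R[i]) (i : 'I_d)
  (l : seq 'I_d) (w v e : R -> R).
Local Notation mu := (@lebesgue_measure R).

(** The squared norm changes by [2 h xi_i + h^2], and [|h xi_i| <= |xi|^2 / 4]. The segment thus
    stays in a compact set away from the origin, where weights are bounded. *)
Lemma enorm_line xi i (h : R) : xi != 0 -> `|h| <= enorm xi / 4 ->
  enorm xi / 2 <= enorm (h *: delta_mx ord0 i + xi) <= 2 * enorm xi.
Proof.
move=> x0; set p := enorm xi => hp.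
have p0 : 0 < p by rewrite /p enorm_gt0.
have Ei : enorm (h *: delta_mx ord0 i + xi) ^+ 2 =
    p ^+ 2 + 2 * h * xi ord0 i + h ^+ 2.
  rewrite /p !enorm_sqr [in RHS](bigD1 i)//= (bigD1 i)//= !mxE !eqxx mulr1.
  rewrite (eq_bigr (fun j => xi ord0 j ^+ 2)); first by ring.
  by move=> j /negbTE ji; rewrite !mxE ji andbF mulr0 add0r.
have xip := le_coord_enorm xi i; rewrite -/p in xip.
have hx : `|h * xi ord0 i| <= p / 4 * p by rewrite normrM ler_pM.
move: hp hx; rewrite !ler_norml => /andP[h1 h2] /andP[hx1 hx2].
have n0 := enorm_ge0 (h *: delta_mx ord0 i + xi).
apply/andP; split.
- rewrite -(@ler_pXn2r _ 2) ?nnegrE ?divr_ge0 ?(ltW p0)// Ei.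
  by have := sqr_ge0 h; rewrite -mulrA; nra.
- rewrite -(@ler_pXn2r _ 2) ?nnegrE ?mulr_ge0 ?(ltW p0)// Ei.
  by rewrite -mulrA; nra.
Qed.

Lemma line_neq0 xi i (h : R) : xi != 0 -> `|h| <= enorm xi / 4 ->
  h *: delta_mx ord0 i + xi != 0.
Proof.
move=> x0 hp; have /andP[H _] := enorm_line i x0 hp.
by rewrite -enorm_gt0 (lt_le_trans _ H)// divr_gt0// enorm_gt0.
Qed.

(** Supplies the constant for dominated differentiation. Unlike monotonicity, this property survives
    the passage from [w r] to [w r / r]. *)
Definition bounded_on_segments w :=
  forall x y, 0 < x -> exists M, forall r, x <= r <= y -> w r <= M.

Lemma bounded_on_segments_div w :
  bounded_on_segments w -> bounded_on_segments (fun r => w r / r).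
Proof.
move=> bw x y x0; have [M HM] := bw x y x0; exists (`|M| / x) => r /[dup] /HM wM /andP[xr ry].
have r0 := lt_le_trans x0 xr.
rewrite ler_pdivrMr// mulrAC ler_pdivlMr//.
by rewrite (le_trans (ler_wpM2r (ltW x0) (le_trans wM (ler_norm M))))// ler_wpM2l.
Qed.

Variables (i : 'I_d) (s t : R) (G : R -> 'rV[R]_d -> R) (w : R -> R).
Hypothesis bw : bounded_on_segments w.
Hypothesis mG : forall xi, xi != 0 -> measurable_fun [set: R] (G ^~ xi).
Hypothesis Gw : forall r xi, xi != 0 -> `|G r xi| <= w (enorm xi).
Hypothesis dG : forall r xi, xi != 0 -> derivable (G r) xi (delta_mx ord0 i).
Hypothesis dGw : forall r xi, xi != 0 ->
  `|'D_(delta_mx ord0 i) (G r) xi| <= w (enorm xi) / enorm xi.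

(** The derivative is a pointwise limit of difference quotients, each measurable in time. *)
Lemma measurable_partial xi : xi != 0 ->
  measurable_fun [set: R] (fun r => 'D_(delta_mx ord0 i) (G r) xi).
Proof.
move=> x0; set v := delta_mx ord0 i.
have p0 : 0 < enorm xi by rewrite enorm_gt0.
(* Nonzero steps tending to [0], at most [|xi| / 4] so that the shifted points avoid the origin. *)
pose h (n : nat) : R := enorm xi / 4 * n.+1%:R^-1.
have h0 n : 0 < h n by rewrite /h !mulr_gt0 ?invr_gt0 ?ltr0n.
have hp n : `|h n| <= enorm xi / 4.
  by rewrite gtr0_norm// /h ler_piMr ?divr_ge0 ?(ltW p0)// invf_le1 ?ltr0n// ler1n.
have hcvg : h n @[n --> \oo] --> 0.
  rewrite -[X in _ --> X](mulr0 (enorm xi / 4)).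
  by apply: cvgM; [exact: cvg_cst|exact: cvg_harmonic].
apply: (measurable_fun_cvg (h :=
  fun n r => (h n)^-1 * (G r (h n *: v + xi) - G r xi))) => [n|r _].
  apply: measurable_funM => //; apply: measurable_funB; last exact: mG.
  by apply: mG; exact: line_neq0.
have /cvg_ex[/= L HL] := @dG r _ x0.
have -> : 'D_v (G r) xi = L by apply/cvg_lim.
have /cvgr_dnbhsP/(_ h) := HL; apply; split => // n.
by rewrite gt_eqF.
Qed.

(** For [|h| < |xi| / 4] the shifted point has norm between [|xi| / 2] and [2 |xi|], so one constant
    dominates all derivatives of the integrand there, and it is integrable on [[s, t]]. *)
Lemma is_derive_Rintegral xi : xi != 0 ->
  is_derive xi (delta_mx ord0 i) (fun x => \int[mu]_(r in `[s, t]) G r x)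
    (\int[mu]_(r in `[s, t]) 'D_(delta_mx ord0 i) (G r) xi).
Proof.
move=> x0; set v := delta_mx ord0 i.
have p0 : 0 < enorm xi by rewrite enorm_gt0.
have e : 0 *: v + xi = xi by rewrite scale0r add0r.
rewrite -{1}e; apply/is_derive_lineP.
pose q := enorm xi / 4; have q0 : 0 < q by rewrite divr_gt0.
have [M HM] := @bounded_on_segments_div w bw (enorm xi / 2) (2 * enorm xi) (divr_gt0 p0 (ltr0n R 2)).
have I h : `]-q, q[%classic h -> `|h| <= enorm xi / 4.
  by rewrite /= in_itv/= => /andP[/ltW ? /ltW ?]; rewrite ler_norml; apply/andP.
have I0 : `]-q, q[%classic (0 : R) by rewrite /= in_itv/= oppr_lt0 q0.
pose F (h : R) r := G r (h *: v + xi).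
have DF h r : `]-q, q[%classic h -> is_derive h 1 (F ^~ r) ('D_v (G r) (h *: v + xi)).
  move=> /I hq; have D := derivableP (@dG r _ (line_neq0 i x0 hq)).
  exact: (proj1 (is_derive_lineP (G r) xi v h _) D).
have intF h : `]-q, q[%classic h -> mu.-integrable `[s, t] (EFin \o F h).
  move=> /I hq; apply: (@integrable_bounded_itv _ _ _ _ (w (enorm (h *: v + xi)))).
    by apply: mG; exact: line_neq0.
  by move=> r; apply: Gw; exact: line_neq0.
have derF h r : `]-q, q[%classic h -> `[s, t]%classic r -> derivable (F ^~ r) h 1.
  by move=> /DF + _ => /(_ r) [].
have FM h r : `]-q, q[%classic h -> `[s, t]%classic r ->
    `|partial1of2 F h r| <= `|M|.
  move=> hq _; rewrite partial1of2E; have [_ ->] := DF h r hq.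
  have hq' := I _ hq.
  rewrite (le_trans (@dGw _ _ (line_neq0 i x0 hq')))//.
  rewrite (le_trans _ (ler_norm M))//; apply: HM.
  exact: enorm_line.
have iM : mu.-integrable `[s, t] (EFin \o (fun=> `|M|)).
  apply: (@integrable_bounded_itv _ _ _ _ `|M|) => // r.
  by rewrite normr_id.
have mI : measurable (`[s, t]%classic : set (measurableTypeR R)) by [].
have DI := @derivable_under_integral R _ _ mu F _ mI 0 _ _ I0 intF derF
  (fun=> `|M|) (fun=> normr_ge0 M) iM FM.
have vI := @differentiation_under_integral R _ _ mu F _ mI 0 _ _ I0 intF derF
  (fun=> `|M|) (fun=> normr_ge0 M) iM FM.
split; first exact: DI.
rewrite -derive1E vI.
apply: eq_Rintegral => r _; rewrite partial1of2E.
by have [_ ->] := DF 0 r I0; rewrite e.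
Qed.

End symbol_integral.

(** * Time integrals of symbols *)

Section symbol_Cintegral.
Context {R : realType} {d : nat}.
Implicit Types (xi : 'rV[R]_d) (l : seq 'I_d) (w : R -> R)
  (F : R -> 'rV[R]_d -> R[i]).

(** Derivatives commute with the integral and the modulus is estimated only at the end of the
    induction, through [|Re| + |Im|]. Hence a single factor [2], whatever the length of [l]. *)
Lemma symb_Cintegral l w F (s t : R) : s < t -> bounded_on_segments w ->
  (forall r, symb l w (F r)) ->
  (forall xi, xi != 0 -> measurable_fun [set: R] (fun r => complex.Re (F r xi))) ->
  (forall xi, xi != 0 -> measurable_fun [set: R] (fun r => complex.Im (F r xi))) ->
  symb l (fun r => 2 * (t - s) * w r) (fun x => Cintegral s t (fun r => F r x)).
Proof.
move=> st; elim: l w F => [|i l IH] w F bw SF mRe mIm.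
  move=> xi x0; rewrite (le_trans (normc_le_ReIm _))//=.
  rewrite -mulrA mulrDl mul1r lerD//; apply: normr_Rintegral_itv => //.
  - exact: mRe.
  - by move=> r; rewrite (le_trans (normr_Re _))//; exact: SF.
  - exact: mIm.
  - by move=> r; rewrite (le_trans (normr_Im _))//; exact: SF.
have S0 r xi : xi != 0 -> Normc.normc (F r xi) <= w (enorm xi).
  by move=> x0; exact: (symb_bound0 (SF r)).
have S1 r xi : xi != 0 -> Normc.normc (partial i (F r) xi) <= w (enorm xi) / enorm xi.
  by move=> x0; have [_ _ H] := SF r; exact: (symb_bound0 H).
have D1 r xi : xi != 0 -> has_partial i (F r) xi.
  by move=> x0; have [H _ _] := SF r; exact: H.
have dRe r xi : xi != 0 -> derivable (fun x => complex.Re (F r x)) xi (delta_mx ord0 i).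
  by move=> x0; have [] := D1 r _ x0.
have dIm r xi : xi != 0 -> derivable (fun x => complex.Im (F r x)) xi (delta_mx ord0 i).
  by move=> x0; have [] := D1 r _ x0.
have bRe r xi : xi != 0 -> `|complex.Re (F r xi)| <= w (enorm xi).
  by move=> x0; rewrite (le_trans (normr_Re _))// S0.
have bIm r xi : xi != 0 -> `|complex.Im (F r xi)| <= w (enorm xi).
  by move=> x0; rewrite (le_trans (normr_Im _))// S0.
have bdRe r xi : xi != 0 -> `|'D_(delta_mx ord0 i) (fun x => complex.Re (F r x)) xi| <=
    w (enorm xi) / enorm xi.
  by move=> x0; rewrite (le_trans (normr_Re (partial i (F r) xi)))// S1.
have bdIm r xi : xi != 0 -> `|'D_(delta_mx ord0 i) (fun x => complex.Im (F r x)) xi| <=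
    w (enorm xi) / enorm xi.
  by move=> x0; rewrite (le_trans (normr_Im (partial i (F r) xi)))// S1.
apply: (symb_cons (g := fun x => Cintegral s t (fun r => partial i (F r) x))).
- move=> xi x0; split.
  + exact: (is_derive_Rintegral s t bw mRe bRe dRe bdRe x0).
  + exact: (is_derive_Rintegral s t bw mIm bIm dIm bdIm x0).
- by apply: IH => // r; have [] := SF r.
- have H : symb l (fun r => 2 * (t - s) * (w r / r))
      (fun x => Cintegral s t (fun r => partial i (F r) x)).
    apply: IH; first exact: bounded_on_segments_div.
    + by move=> r; have [] := SF r.
    + move=> xi x0; exact: (measurable_partial mRe dRe x0).
    + move=> xi x0; exact: (measurable_partial mIm dIm x0).
  by apply: symb_le H => r r0; rewrite mulrA.
Qed.

End symbol_Cintegral.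

(** * Multi-indices as sorted lists of directions *)

Section multi_index_dirs.
Context {d : nat}.
Implicit Types (alpha : multi_index d) (l : seq 'I_d).

Definition ord_le : rel 'I_d := fun i j => (i <= j)%N.

Lemma ord_le_trans : transitive ord_le.
Proof. by move=> j i k; exact: leq_trans. Qed.

Lemma sorted_mi_dirs alpha : sorted ord_le (mi_dirs alpha).
Proof.
rewrite /mi_dirs (sorted_pairwise ord_le_trans).
have : pairwise (fun i j : 'I_d => (i < j)%N) (enum 'I_d).
  rewrite -(@sorted_pairwise _ (fun i j : 'I_d => (i < j)%N)); last first.
    by move=> j i k; exact: ltn_trans.
  rewrite -(@sorted_map _ _ (@nat_of_ord d) ltn) val_enum_ord.
  exact: iota_ltn_sorted.
elim: (enum 'I_d) => //= i l IH /andP[il /IH Hl].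
rewrite pairwise_cat Hl andbT; apply/andP; split.
  apply/allrelP => x y; rewrite mem_nseq => /andP[_ /eqP ->].
  move=> /flatten_mapP[j jl]; rewrite mem_nseq => /andP[_ /eqP ->].
  by rewrite /ord_le ltnW//; exact: (allP il).
apply/(pairwiseP i) => x y; rewrite !inE !size_nseq => xa ya _.
by rewrite !nth_nseq xa ya /ord_le.
Qed.

Lemma size_mi_dirs alpha : size (mi_dirs alpha) = mi_order alpha.
Proof.
rewrite size_flatten /shape -map_comp sumnE big_map big_enum/=.
by apply: eq_bigr => i _; rewrite size_nseq.
Qed.

(** A sorted list is determined by its multiplicities. The hypotheses on [psi] concern multi-indices
    only, so they become available for every sorted list of directions. *)
Lemma mi_dirsP l : sorted ord_le l -> exists alpha, mi_dirs alpha = l.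
Proof.
move=> sl; exists [ffun i => count_mem i l].
apply: (sorted_eq ord_le_trans) => //; last 2 first.
- exact: sorted_mi_dirs.
- apply/allP => i _ /=; apply/eqP.
  rewrite count_flatten -map_comp sumnE big_map big_enum/= (bigD1 i)//=.
  rewrite count_nseq /= eqxx mul1n ffunE big1 ?addn0// => j /negbTE ji.
  by rewrite count_nseq /= ji.
- by move=> i j /andP[ij ji]; apply/val_inj/eqP; rewrite eqn_leq; apply/andP.
Qed.

Lemma mi_dirs_nil alpha : (mi_dirs alpha == [::]) = (alpha == mi0 d).
Proof.
apply/eqP/eqP => [e|->].
  apply/ffunP => i; rewrite ffunE; apply/eqP; rewrite -leqn0.
  have : mi_order alpha = 0%N by rewrite -size_mi_dirs e.
  by rewrite /mi_order (bigD1 i)//= => /eqP; rewrite addn_eq0 => /andP[/eqP ->].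
apply: size0nil; rewrite size_mi_dirs /mi_order big1// => i _.
by rewrite ffunE.
Qed.

End multi_index_dirs.

(** * The rescaled symbol and the exponent as symbols *)

Section symbol_assumptions_symb.
Context {R : realType} {d : nat}.
Implicit Types (xi : 'rV[R]_d) (l acc : seq 'I_d).
Variables (gamma nu : R) (psi : R -> 'rV[R]_d -> R[i]).
Hypothesis Hpsi : symbol_assumptions gamma nu psi.
Hypothesis nu_gt0 : 0 < nu.
Hypothesis gamma_gt0 : 0 < gamma.

(** The list [acc] records the derivatives already taken. Sortedness of [rev l ++ acc] passes to its
    subsequences, so every derivative met in the induction is some [Dmulti alpha (psi t)] of
    admissible order. *)
Lemma symb_foldr_partial l acc t : sorted ord_le (rev l ++ acc) ->
  (size l + size acc <= max_order d)%N ->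
  symb l (fun r => nu^-1 * r `^ (gamma - (size acc)%:R))
    (foldr (@partial R d) (psi t) acc).
Proof.
elim: l acc => [|i l IH] acc /=.
  move=> /mi_dirsP[alpha <-]; rewrite size_mi_dirs => sa xi x0.
  exact: (symbol_bounded Hpsi).
rewrite rev_cons cat_rcons => Hs sz; split.
- move=> xi x0.
  have /mi_dirsP[alpha ea] : sorted ord_le (i :: acc).
    apply: subseq_sorted Hs; first exact: ord_le_trans.
    exact: suffix_subseq.
  have := @symbol_derivable _ _ _ _ _ Hpsi t xi alpha x0.
  rewrite -size_mi_dirs /has_Dmulti ea /=; apply.
  by rewrite (leq_trans _ sz)// addSn ltnS leq_addl.
- apply: IH; last by rewrite (leq_trans _ sz)// leq_add2r leqnSn.
  apply: subseq_sorted Hs; first exact: ord_le_trans.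
  by rewrite cat_subseq// subseq_cons.
- apply: symb_le (IH (i :: acc) Hs _) => [r r0|]; last by rewrite /= addnS.
  rewrite -[(size (i :: acc))%:R]natr1 opprD addrA powRB1//.
  by rewrite mulrA.
Qed.

Lemma symb_psi (alpha : multi_index d) t : (mi_order alpha <= max_order d)%N ->
  symb (rev (mi_dirs alpha)) (fun r => nu^-1 * r `^ gamma) (psi t).
Proof.
move=> ha.
have := @symb_foldr_partial (rev (mi_dirs alpha)) [::] t.
rewrite revK cats0 /= subr0 size_rev size_mi_dirs addn0; apply => //.
exact: sorted_mi_dirs.
Qed.

Lemma measurable_psi_time xi :
  measurable_fun [set: R] (fun r => complex.Re (psi r xi)) /\
  measurable_fun [set: R] (fun r => complex.Im (psi r xi)).
Proof.
have [mRe mIm] := symbol_measurable Hpsi.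
have mp : measurable_fun [set: R] (fun r : R => (r, xi)) by exact: pair2_measurable.
split.
- exact: (measurableT_comp mRe mp).
- exact: (measurableT_comp mIm mp).
Qed.

Variables (s t : R).
Hypothesis st : s < t.
Let k := (t - s) `^ (- gamma^-1).

Let k_gt0 : 0 < k.
Proof. by rewrite powR_gt0// subr_gt0. Qed.

(** This is why the dilation factor is [(t - s)^(-1/gamma)]: the length of the time interval cancels
    in every weight. *)
Let k_gamma : (t - s) * k `^ gamma = 1.
Proof.
have ts0 : 0 < t - s by rewrite subr_gt0.
rewrite /k -powRrM mulNr mulVf ?gt_eqF// powR_inv1 ?ltW// divff// gt_eqF//.
Qed.

Let kr (r : R) : 0 < r -> (k * r) `^ gamma = k `^ gamma * r `^ gamma.
Proof. by move=> r0; rewrite powRM// ltW. Qed.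

Lemma symb_scaled_psi (alpha : multi_index d) : (mi_order alpha <= max_order d)%N ->
  symb (rev (mi_dirs alpha)) (fun r => nu^-1 * r `^ gamma)
    (fun x => (t - s)%:C * psi t (k *: x)).
Proof.
move=> /(symb_psi t)/(symb_scale k_gt0)/(symbZ (t - s)%:C); apply: symb_le => r r0.
rewrite normc_real gtr0_norm ?subr_gt0// kr// mulrCA [(t - s) * _]mulrA k_gamma.
by rewrite mul1r.
Qed.

Lemma symb_exponent (alpha : multi_index d) : (mi_order alpha <= max_order d)%N ->
  symb (rev (mi_dirs alpha)) (fun r => 2 * nu^-1 * r `^ gamma)
    (fun x => Cintegral s t (fun r => psi r (k *: x))).
Proof.
move=> ha.
have H := @symb_Cintegral _ _ (rev (mi_dirs alpha))
  (fun r => nu^-1 * (k * r) `^ gamma) (fun r x => psi r (k *: x)) s t st.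
apply: symb_le (H _ _ _ _).
- move=> r r0; rewrite kr// -!mulrA ler_wpM2l//.
  by rewrite mulrCA [(t - s) * _]mulrA k_gamma mul1r.
(* The weight increases with [r], so its value at the right endpoint bounds it on the segment. *)
- move=> x y x0; exists (nu^-1 * (k * y) `^ gamma) => r /andP[xr ry].
  have r0 := lt_le_trans x0 xr; have y0 := lt_le_trans r0 ry.
  rewrite ler_wpM2l ?invr_ge0 ?(ltW nu_gt0)// ge0_ler_powR ?(ltW gamma_gt0)//.
  + by rewrite nnegrE mulr_ge0 ?ltW.
  + by rewrite nnegrE mulr_ge0 ?ltW.
  + by rewrite ler_wpM2l// ltW.
- by move=> r; exact: (symb_scale k_gt0 (symb_psi r ha)).
- by move=> xi _; have [] := measurable_psi_time (k *: xi).
- by move=> xi _; have [] := measurable_psi_time (k *: xi).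
Qed.

(** Ellipticity is integrated over [[s, t]], and [(t - s) k^gamma = 1] removes the length. *)
Lemma expR_Re_exponent xi : xi != 0 ->
  expR (complex.Re (Cintegral s t (fun r => psi r (k *: xi)))) <=
  expR (- nu * enorm xi `^ gamma).
Proof.
move=> x0; rewrite ler_expR /=.
have r0 : 0 < enorm xi by rewrite enorm_gt0.
have kx0 : k *: xi != 0 by rewrite scaler_eq0 gt_eqF.
have [mRe _] := measurable_psi_time (k *: xi).
(* The bound of order zero gives integrability in time, which the comparison of integrals
   requires. *)
have bRe r : `|complex.Re (psi r (k *: xi))| <= nu^-1 * enorm (k *: xi) `^ gamma.
  rewrite (le_trans (normr_Re _))//.
  have := @symbol_bounded _ _ _ _ _ Hpsi r (k *: xi) (mi0 d) kx0.
  have e0 : mi_order (mi0 d) = 0%N by rewrite /mi_order big1// => i _; rewrite ffunE.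
  have := mi_dirs_nil (mi0 d); rewrite eqxx => /eqP e1.
  by rewrite /Dmulti e0 e1 /= subr0; apply.
apply: (@le_trans _ _ (\int[@lebesgue_measure R]_(r in `[s, t])
   (- nu * enorm (k *: xi) `^ gamma))).
  apply: le_Rintegral => //.
  - exact: integrable_bounded_itv bRe.
  - exact: (@integrable_bounded_itv _ _ _ _ `|- nu * enorm (k *: xi) `^ gamma|).
  - by move=> r _; exact: (symbol_elliptic Hpsi).
rewrite Rintegral_itv_cst// enormZ ?(ltW k_gt0)// kr// mulrCA.
by rewrite [(t - s) * _]mulrA k_gamma mul1r.
Qed.

End symbol_assumptions_symb.

(** * Polynomials against exponentials *)

Section exponential_domination.
Context {R : realType}.

(** Half of the rate absorbs one factor, by [1 + y <= (1 + 2 / c) (1 + c y / 2) <= (1 + 2 / c) exp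
    (c y / 2)]; the other half goes to the induction. *)
Lemma expr_le_expR (m : nat) (c : R) : 0 < c -> exists2 C, 0 < C &
  forall y, 0 <= y -> (1 + y) ^+ m <= C * expR (c * y).
Proof.
elim: m c => [|m IH] c c0.
  exists 1 => // y y0; rewrite expr0 mul1r.
  by rewrite (le_trans _ (expR_ge1Dx _))// lerDl mulr_ge0// ltW.
have c20 : 0 < c / 2 by rewrite divr_gt0.
have [C C0 H] := IH _ c20.
have K0 : 0 < 1 + (c / 2)^-1 by rewrite addr_gt0 ?invr_gt0.
exists ((1 + (c / 2)^-1) * C) => [|y y0]; first by rewrite mulr_gt0.
have -> : c * y = c / 2 * y + c / 2 * y by field.
rewrite exprS expRD mulrACA ler_pM ?H// ?exprn_ge0 ?addr_ge0//.
rewrite (@le_trans _ _ ((1 + (c / 2)^-1) * (1 + c / 2 * y)))//; last first.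
  by rewrite ler_wpM2l ?(ltW K0)// expR_ge1Dx.
have -> : (1 + (c / 2)^-1) * (1 + c / 2 * y) = 1 + y + (c / 2 * y + (c / 2)^-1).
  by field; rewrite gt_eqF.
by rewrite lerDl addr_ge0 ?invr_ge0 ?(mulr_ge0 (ltW c20)) ?(ltW c20).
Qed.

End exponential_domination.

(** * Pointwise bounds on the kernel *)

Section qhat_bound.
Context {R : realType} {d : nat}.
Variables (gamma nu : R) (a : nat) (b : R).
Hypothesis gamma_gt0 : 0 < gamma.
Hypothesis nu_gt0 : 0 < nu.
Implicit Types (psi : R -> 'rV[R]_d -> R[i]) (alpha : multi_index d) (xi : 'rV[R]_d).

Let v (r : R) := 2 * nu^-1 * r `^ gamma.
Let e (r : R) := expR (- nu * r `^ gamma).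

Let v_ge0 (r : R) : 0 < r -> 0 <= v r.
Proof. by move=> _; rewrite !mulr_ge0 ?invr_ge0 ?powR_ge0 ?(ltW nu_gt0). Qed.

Let e_ge0 (r : R) : 0 < r -> 0 <= e r.
Proof. by move=> _; exact: expR_ge0. Qed.

Lemma qhat_le n : exists2 K, 0 <= K & forall psi alpha,
  symbol_assumptions gamma nu psi -> (mi_order alpha <= max_order d)%N ->
  mi_order alpha = n -> forall s t xi, s < t -> xi != 0 ->
  Normc.normc (qhat gamma psi alpha a b s t xi) <=
  K * enorm xi `^ (gamma * a%:R + b - n%:R) * ((1 + v (enorm xi)) ^+ n * e (enorm xi)).
Proof.
have [C1 C10 H1] := @symbX R d n a.
have [C2 C20 H2] := @symb_enorm_powR R d n b.
have [C3 C30 H3] := @symb_expC R d n.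
(* Each [2 ^+ n] is the Leibniz loss of one of the two products between the three factors. *)
pose K := 2 ^+ n * (2 ^+ n * C1 * nu^-1 ^+ a * C2) * C3.
have nui : 0 <= nu^-1 by rewrite invr_ge0 ltW.
exists K; first by rewrite !mulr_ge0// exprn_ge0.
move=> psi alpha Hpsi ha han s t xi st x0.
have ln : size (rev (mi_dirs alpha)) = n by rewrite size_rev size_mi_dirs.
have P0 (r : R) : 0 < r -> 0 <= nu^-1 * r `^ gamma.
  by move=> _; rewrite mulr_ge0 ?powR_ge0.
have S1 := H1 _ _ _ ln P0 (symb_scaled_psi Hpsi gamma_gt0 st ha).
have S2 := H2 _ ln.
have S3 := H3 _ _ _ _ ln v_ge0 e_ge0 (expR_Re_exponent Hpsi gamma_gt0 st)
  (symb_exponent Hpsi nu_gt0 gamma_gt0 st ha).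
have W1 (r : R) : 0 < r -> 0 <= C1 * (nu^-1 * r `^ gamma) ^+ a.
  by move=> r0; rewrite mulr_ge0// exprn_ge0// P0.
have W2 (r : R) : 0 < r -> 0 <= C2 * r `^ b.
  by move=> r0; rewrite mulr_ge0// powR_ge0.
have W3 (r : R) : 0 < r -> 0 <= C3 * (1 + v r) ^+ n * e r.
  by move=> r0; rewrite !mulr_ge0 ?exprn_ge0 ?addr_ge0 ?v_ge0 ?e_ge0.
have S12 := symbM W1 W2 S1 S2.
have W12 (r : R) : 0 < r ->
  0 <= 2 ^+ size (rev (mi_dirs alpha)) * (C1 * (nu^-1 * r `^ gamma) ^+ a) * (C2 * r `^ b).
  by move=> r0; rewrite mulr_ge0 ?W2// mulr_ge0 ?W1// exprn_ge0.
have := symb_bound (symbM W12 W3 S12 S3) x0.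
rewrite revK ln => /le_trans; apply.
set r := enorm xi; have r0 : 0 < r by rewrite /r enorm_gt0.
rewrite le_eqVlt; apply/orP; left; apply/eqP.
rewrite powRB ?(gt_eqF r0) ?implybT// powRD ?(gt_eqF r0) ?implybT//.
rewrite powRrM !powR_mulrn ?powR_ge0 ?(ltW r0)// exprMn /K.
by field; rewrite expf_neq0 ?(gt_eqF r0) ?gt_eqF.
Qed.

(** Here only the exponential remains, and one of the [n.+1] derivatives is spent on its exponent;
    the extra factor [|xi|^gamma] comes from there. *)
Lemma qhat00_le n : exists2 K, 0 <= K & forall psi alpha,
  symbol_assumptions gamma nu psi -> (mi_order alpha <= max_order d)%N ->
  mi_order alpha = n.+1 -> forall s t xi, s < t -> xi != 0 ->
  Normc.normc (qhat gamma psi alpha 0 0 s t xi) <=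
  K * enorm xi `^ (gamma - n.+1%:R) * ((1 + v (enorm xi)) ^+ n * e (enorm xi)).
Proof.
have [C C0 H] := @symb_partial_expC R d n.
have nui : 0 <= nu^-1 by rewrite invr_ge0 ltW.
exists (C * (2 * nu^-1)); first by rewrite !mulr_ge0.
move=> psi alpha Hpsi ha han s t xi st x0.
have Sf := symb_exponent Hpsi nu_gt0 gamma_gt0 st ha.
have rK := revK (mi_dirs alpha).
(* The head [i] of the reversed list is the innermost derivative, the one that hits the exponential
   first. *)
case E : (rev (mi_dirs alpha)) rK Sf => [|i l] rK Sf.
  by move: han; rewrite -size_mi_dirs -size_rev E.
have ln : size l = n by move: han; rewrite -size_mi_dirs -size_rev E => -[].
have S := H _ _ _ _ _ ln v_ge0 e_ge0 (expR_Re_exponent Hpsi gamma_gt0 st) Sf.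
have := symb_bound S x0.
have -> : qhat gamma psi alpha 0 0 s t xi = foldr (@partial R d)
   (partial i (fun x => expC (Cintegral s t (fun r => psi r ((t - s) `^ (- gamma^-1) *: x)))))
   (rev l) xi.
  rewrite /qhat /Dmulti -rK rev_cons foldr_rcons; congr (foldr _ (partial i _) _ _).
  by apply/funext => x /=; rewrite expr0 powRr0 !mul1r.
move=> /le_trans; apply; rewrite ln.
set r := enorm xi; have r0 : 0 < r by rewrite /r enorm_gt0.
rewrite le_eqVlt; apply/orP; left; apply/eqP.
rewrite powRB ?(gt_eqF r0) ?implybT// !powR_mulrn ?(ltW r0)// exprS /v.
by field; rewrite expf_neq0 ?(gt_eqF r0) ?gt_eqF.
Qed.

(** Order of the bound near the origin. It gains [gamma] over the generic value when only the
    exponential is present and is differentiated. *)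
Definition qhat_exponent (n : nat) : R :=
  if [&& a == 0%N, b == 0 & n != 0%N] then gamma - n%:R
  else gamma * a%:R + b - n%:R.

Lemma sqr_decay_le (m : nat) : exists2 C : R, 0 < C & forall (p q K r : R), 0 < r ->
  0 <= K -> 0 <= q ->
  q <= K * r `^ p * ((1 + 2 * nu^-1 * r `^ gamma) ^+ m * expR (- nu * r `^ gamma)) ->
  q ^+ 2 <= K ^+ 2 * C * (r `^ (2 * p) * expR (- nu * r `^ gamma)).
Proof.
(* The rate makes [c * (2 nu^-1 r^gamma) = nu r^gamma]: squaring yields [exp (- 2 nu r^gamma)], and
   half of it pays for the polynomial factor. *)
have c0 : 0 < nu ^+ 2 / 2 by rewrite divr_gt0// exprn_gt0.
have [C C0 H] := expr_le_expR (m * 2) c0; exists C => // p q K r r0 K0 q0 qle.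
have x0 : 0 <= r `^ gamma by exact: powR_ge0.
have y0 : 0 <= 2 * nu^-1 * r `^ gamma by rewrite !mulr_ge0// invr_ge0 ltW.
have := H _ y0.
have -> : nu ^+ 2 / 2 * (2 * nu^-1 * r `^ gamma) = nu * r `^ gamma.
  by field; rewrite gt_eqF.
move=> {}H; rewrite (@le_trans _ _ (K ^+ 2 * r `^ (2 * p) *
   ((1 + 2 * nu^-1 * r `^ gamma) ^+ (m * 2) * expR (- nu * r `^ gamma) ^+ 2)))//.
  rewrite (le_trans (lerXn2r 2 q0 _ qle)) ?nnegrE//.
    by rewrite (le_trans q0 qle).
  rewrite !exprMn exprM mulrC -[r `^ p ^+ 2]powR_mulrn ?powR_ge0//.
  by rewrite -powRrM [p * _]mulrC [leRHS]mulrC.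
have -> : K ^+ 2 * C * (r `^ (2 * p) * expR (- nu * r `^ gamma)) =
   K ^+ 2 * r `^ (2 * p) * (C * expR (nu * r `^ gamma) * expR (- nu * r `^ gamma) ^+ 2).
  have -> : expR (nu * r `^ gamma) = (expR (- nu * r `^ gamma))^-1.
    by rewrite -expRN mulNr opprK.
  by field; rewrite gt_eqF ?expR_gt0.
by rewrite ler_wpM2l ?mulr_ge0 ?sqr_ge0 ?powR_ge0// ler_wpM2r ?sqr_ge0.
Qed.

Lemma sqr_qhat_le n : exists2 K, 0 <= K & forall psi alpha,
  symbol_assumptions gamma nu psi -> (mi_order alpha <= max_order d)%N ->
  mi_order alpha = n -> forall s t xi, s < t -> xi != 0 ->
  Normc.normc (qhat gamma psi alpha a b s t xi) ^+ 2 <=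
  K * (enorm xi `^ (2 * qhat_exponent n) * expR (- nu * enorm xi `^ gamma)).
Proof.
rewrite /qhat_exponent; case: ifPn => [/and3P[/eqP -> /eqP -> n0]|_].
  case: n n0 => // n _.
  have [K K0 H] := qhat00_le n.
  have [C C0 HC] := sqr_decay_le n.
  exists (K ^+ 2 * C) => [|psi alpha Hpsi ha han s t xi st x0].
    by rewrite mulr_ge0 ?sqr_ge0// ltW.
  apply: HC => //; rewrite ?enorm_gt0// ?normc_ge0//.
  exact: H.
have [K K0 H] := qhat_le n.
have [C C0 HC] := sqr_decay_le n.
exists (K ^+ 2 * C) => [|psi alpha Hpsi ha han s t xi st x0].
  by rewrite mulr_ge0 ?sqr_ge0// ltW.
apply: HC => //; rewrite ?enorm_gt0// ?normc_ge0//.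
exact: H.
Qed.

End qhat_bound.

(** * Telescoping bounds for powers with exponential decay *)

Section telescoping.
Context {R : realType}.
Variables (gamma c : R).
Hypothesis gamma_gt0 : 0 < gamma.
Hypothesis c_gt0 : 0 < c.

(** With an integer [M >= q / gamma], [r^q] is at most [(1 + r^gamma)^M], a polynomial in
    [r^gamma]. *)
Lemma powR_le_expR (q : R) (m : nat) : 0 <= q -> exists2 C, 0 < C &
  forall r, 0 < r -> (1 + r `^ q) ^+ m <= C * expR (c * r `^ gamma).
Proof.
move=> q0; pose M := Num.bound (q / gamma).
have qM : q / gamma <= M%:R by rewrite ltW// archi_boundP// divr_ge0// ltW.
have [C C0 H] := expr_le_expR (M * m) c_gt0.
exists (2 ^+ m * C) => [|r r0]; first by rewrite mulr_gt0// exprn_gt0.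
have x0 : 0 <= r `^ gamma by exact: powR_ge0.
have x1 : 1 <= 1 + r `^ gamma by rewrite lerDl.
have rq : r `^ q <= (1 + r `^ gamma) ^+ M.
  rewrite -[q](divfK (lt0r_neq0 gamma_gt0)) [_ * gamma]mulrC powRrM.
  rewrite -powR_mulrn ?addr_ge0// (le_trans _ (ler_powR x1 qM))//.
  by rewrite ge0_ler_powR ?divr_ge0 ?(ltW gamma_gt0) ?nnegrE ?addr_ge0// lerDr.
rewrite (@le_trans _ _ ((2 * (1 + r `^ gamma) ^+ M) ^+ m))//.
  rewrite lerXn2r ?nnegrE ?addr_ge0 ?powR_ge0 ?mulr_ge0 ?exprn_ge0 ?addr_ge0//.
  by rewrite mulrDl mul1r lerD// exprn_ege1.
by rewrite exprMn -exprM -mulrA ler_wpM2l// H.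
Qed.

(* With [r] doubling at each step, the right-hand sides telescope; the gauge
   [G] is [r `^ u], [(1 + r `^ u)^-1] or [ln (1 + r^-1)] according to the sign
   of [u]. *)
Lemma decay_telescope (u : R) : exists (C : R) (G : R -> R),
  [/\ 0 <= C, forall r, 0 < r -> 0 <= G r,
      forall r, 0 < r -> r `^ u * expR (- c * r `^ gamma) <= C * (G r - G (2 * r)) &
      forall eps, 0 < eps -> eps < 1 ->
        G eps <= 1 + eps `^ u + (u == 0)%:R * ln eps^-1].
Proof.
have two_gt1 (q : R) : 0 < q -> 1 < 2 `^ q.
  move=> q0; have := @gt0_ltr_powR R q q0 1 2; rewrite powR1; apply; rewrite ?nnegrE//.
  exact: ltr1n.
have le1 r : expR (- c * r `^ gamma) <= 1.
  by rewrite -expR0 ler_expR mulNr oppr_le0 mulr_ge0 ?powR_ge0// ltW.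
have [u0|u0|u0] := ltgtP u 0.
(* For [u < 0] the power alone telescopes geometrically, and the exponential is bounded by [1]. *)
- have z1 : 2 `^ u < 1.
    by rewrite -[u]opprK powRN invf_lt1 ?two_gt1 ?oppr_gt0// powR_gt0.
  exists (1 - 2 `^ u)^-1, (fun r => r `^ u); split.
  + by rewrite invr_ge0 subr_ge0 ltW.
  + by move=> r _; exact: powR_ge0.
  + move=> r r0; rewrite powRM ?(ltW r0)//.
    have -> : r `^ u - 2 `^ u * r `^ u = (1 - 2 `^ u) * r `^ u by ring.
    rewrite mulKf ?gt_eqF ?subr_gt0//.
    by rewrite ler_piMr ?powR_ge0.
  + by move=> eps _ _; rewrite mul0r addr0 lerDr.
(* For [u > 0], with [x = r^u] and [z = 2^u], the gauge drops by [x (z - 1) / ((1 + x) (1 + z x))],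
   which is at least [x (z - 1) / (z (1 + x)^2)]; the exponential absorbs [(1 + x)^2]. *)
- have [C C0 H] := powR_le_expR 2 (ltW u0).
  set z := 2 `^ u; have z1 : 1 < z by exact: two_gt1.
  exists (C * (z / (z - 1))), (fun r => (1 + r `^ u)^-1); split.
  + by rewrite mulr_ge0 ?divr_ge0 ?subr_ge0 ?(ltW C0) ?(ltW z1) ?(ltW (lt_trans _ z1)).
  + by move=> r _; rewrite invr_ge0 addr_ge0 ?powR_ge0.
  + move=> r r0; rewrite powRM ?(ltW r0)// -/z.
    have {}H := H _ r0; set x := r `^ u in H *.
    have x0 : 0 < x by exact: powR_gt0.
    have z0 : 0 < z by exact: lt_trans z1.
    have zx0 : 0 < 1 + z * x by rewrite addr_gt0// mulr_gt0.
    have x1 : 0 < 1 + x by rewrite addr_gt0.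
    have -> : C * (z / (z - 1)) * ((1 + x)^-1 - (1 + z * x)^-1) =
       x * (C * (z / ((1 + x) * (1 + z * x)))).
      by field; rewrite !gt_eqF ?subr_gt0.
    rewrite ler_wpM2l ?(ltW x0)// mulNr expRN.
    rewrite -[leLHS]div1r ler_pdivrMr ?expR_gt0//.
    rewrite (@le_trans _ _ ((1 + x) ^+ 2 * (z / ((1 + x) * (1 + z * x)))))//; last first.
      by rewrite [leRHS]mulrAC ler_wpM2r// divr_ge0 ?mulr_ge0 ?ltW.
    have -> : (1 + x) ^+ 2 * (z / ((1 + x) * (1 + z * x))) = (z * (1 + x)) / (1 + z * x).
      by field; rewrite !gt_eqF.
    by rewrite ler_pdivlMr// mul1r mulrDr mulr1 lerD2r ltW.
  + move=> eps e0 _; rewrite mul0r addr0.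
    rewrite (@le_trans _ _ 1) ?lerDl ?powR_ge0//.
    by rewrite invf_le1 ?lerDl ?addr_gt0 ?powR_gt0// powR_ge0.
(* For [u = 0] the gauge drops by [- ln (1 - 1 / (2 (1 + r)))], at least [1 / (2 (1 + r))]; the
   exponential absorbs [1 + r]. *)
- have [C C0 H] := powR_le_expR 1 ler01.
  exists (2 * C), (fun r => ln (1 + r^-1)); split.
  + by rewrite mulr_ge0// ltW.
  + by move=> r r0; rewrite ln_ge0// lerDl invr_ge0 ltW.
  + move=> r r0; have := H _ r0; rewrite expr1 powRr1 ?(ltW r0)// => {}H.
    have r20 : 0 < 2 * r by rewrite mulr_gt0.
    have A : 0 < 1 + r^-1 by rewrite addr_gt0 ?invr_gt0.
    have B : 0 < 1 + (2 * r)^-1 by rewrite addr_gt0 ?invr_gt0.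
    rewrite u0 powRr0 mul1r -opprB -ln_div ?posrE//.
    have -> : (1 + (2 * r)^-1) / (1 + r^-1) = 1 + - (2 * (1 + r))^-1.
      by field; rewrite !gt_eqF ?addr_gt0.
    have r1 : 0 < 1 + r by rewrite addr_gt0.
    have y1 : (-1 : R) < - (2 * (1 + r))^-1.
      rewrite ltrN2 invf_lt1 ?mulr_gt0//; lra.
    have L := le_ln1Dx y1.
    rewrite (@le_trans _ _ (2 * C * (2 * (1 + r))^-1))//; last first.
      by rewrite ler_wpM2l ?mulr_ge0 ?(ltW C0)// lerNr.
    have -> : 2 * C * (2 * (1 + r))^-1 = C / (1 + r) by field; rewrite gt_eqF.
    rewrite ler_pdivlMr// mulNr expRN mulrC ler_pdivrMr ?expR_gt0//.
  + move=> eps e0 e1; rewrite mul1r u0 powRr0.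
    (* This isolates [ln eps^-1], leaving [ln (1 + eps) <= eps]. *)
    have -> : 1 + eps^-1 = (1 + eps) * eps^-1.
      by field; rewrite gt_eqF.
    rewrite lnM ?posrE ?invr_gt0 ?addr_gt0// lerD2r.
    rewrite (le_trans (le_ln1Dx _))//; last lra.
    by rewrite (lt_trans _ e0).
Qed.

End telescoping.

(** * Monotonicity of the integral *)

Section integral_domination.
Context d (T : measurableType d) (R : realType) (mu : {measure set T -> \bar R}).
Local Open Scope ereal_scope.

(** The integral of a nonnegative function is a supremum over the simple functions below it, and
    that set grows with the function. It allows comparing [|qhat|^2], built from iterated
    derivatives, with its radial majorant. *)
Lemma ge0_le_integral_nonmeasurable (D : set T) (f g : T -> \bar R) :
  (forall x, D x -> 0 <= f x) -> (forall x, D x -> f x <= g x) ->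
  \int[mu]_(x in D) f x <= \int[mu]_(x in D) g x.
Proof.
move=> f0 fg; have g0 x : D x -> 0 <= g x by move=> Dx; exact: le_trans (f0 _ Dx) (fg _ Dx).
rewrite !ge0_integralE//; apply: le_ereal_sup => _ [h /= hf <-]; exists h => //= x.
rewrite (le_trans (hf x))// !patchE; case: ifPn => // xD.
by apply: fg; rewrite -inE.
Qed.

End integral_domination.

(** * Volumes of balls and of the origin *)

Section euclidean_volume.
Context {R : realType} (d : nat).
Implicit Types rho : R.

Lemma measurable_enorm : measurable_fun [set: 'rV[R]_d] (@enorm R d).
Proof.
rewrite (_ : @enorm R d = (fun x : R => x `^ 2^-1) \o
   (fun x : 'rV[R]_d => \sum_(i < d) x ord0 i ^+ 2)); last first.
  apply/funext => x /=; rewrite powR12_sqrt// sumr_ge0// => i _.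
  exact: sqr_ge0.
apply: measurableT_comp; first exact: measurable_powR.
apply: measurable_sum => i; apply: measurable_funX.
exact: measurable_rV_coord.
Qed.

Lemma measurable_enorm_ge rho : measurable [set xi : 'rV[R]_d | rho <= enorm xi].
Proof.
have := measurable_enorm measurableT (measurable_itv `[rho, +oo[).
rewrite setTI; congr measurable; apply/seteqP; split=> x /=; by rewrite in_itv/= andbT.
Qed.

Lemma measurable_enorm_lt rho : measurable [set xi : 'rV[R]_d | enorm xi < rho].
Proof.
have := measurable_enorm measurableT (measurable_itv `]-oo, rho[).
rewrite setTI; congr measurable; apply/seteqP; split=> x /=; by rewrite in_itv.
Qed.

Lemma measurable_box (A : 'I_d -> set (measurableTypeR R)) :
  (forall i, measurable (A i)) ->
  measurable [set v : 'rV[R]_d | forall i, A i (v ord0 i)].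
Proof.
move=> mA; rewrite (_ : [set _ | _] = \bigcap_(i in [set: 'I_d])
    ((fun v : 'rV[R]_d => v ord0 i) @^-1` A i)).
  apply: fin_bigcap_measurable => [|i _]; first exact: finite_finset.
  rewrite -[X in measurable X]setTI.
  exact: (@measurable_rV_coord R d i measurableT _ (mA i)).
by apply/seteqP; split => v /= Av i; [move=> _|]; exact: Av.
Qed.

(** The ball lies in a cube of side [2 rho]. *)
Lemma lebesgue_rV_ball_le rho : 0 < rho ->
  (lebesgue_rV d [set xi : 'rV[R]_d | (enorm xi < rho)%R] <= ((2 * rho) ^+ d)%:E)%E.
Proof.
move=> rho0; pose A (i : 'I_d) : set (measurableTypeR R) := `[- rho, rho]%classic.
have mA i : measurable (A i) by exact: measurable_itv.
have vol : (\prod_(i < d) lebesgue_measure (A i) = ((2 * rho) ^+ d)%:E)%E.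
  under eq_bigr => i _.
    rewrite /A lebesgue_measure_itv/= lte_fin gtrN// -EFinD opprK -mulr2n -mulr_natl.
    over.
  elim: d => [|n IH]; first by rewrite big_ord0.
  by rewrite big_ord_recl IH -EFinM exprS.
rewrite -vol -lebesgue_rV_box//; apply: le_measure; rewrite ?inE.
- exact: measurable_enorm_lt.
- exact: measurable_box.
- move=> xi /= xr i; rewrite /A/= in_itv/= -ler_norml.
  by rewrite (le_trans (le_coord_enorm _ _))// ltW.
Qed.

(** The origin is a degenerate box. In dimension [0] the measure is a Dirac mass and the claim
    fails. *)
Lemma lebesgue_rV_0 : (0 < d)%N ->
  measurable [set (0 : 'rV[R]_d)] /\ lebesgue_rV d [set (0 : 'rV[R]_d)] = 0%E.
Proof.
move=> d0; pose A (i : 'I_d) : set (measurableTypeR R) := `[0, 0]%classic.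
have mA i : measurable (A i) by exact: measurable_itv.
have -> : [set (0 : 'rV[R]_d)] = [set v : 'rV[R]_d | forall i, A i (v ord0 i)].
  apply/seteqP; split => [x /= -> i|x /= Ax]; first by rewrite mxE /A /= in_itv/= lexx.
  apply/rowP => i; rewrite mxE; have := Ax i.
  by rewrite /A /= in_itv/= => /andP[a b]; apply/eqP; rewrite eq_le a b.
split; first exact: measurable_box.
rewrite lebesgue_rV_box// (bigD1 (Ordinal d0))//=.
by rewrite /A lebesgue_measure_itv/= ltxx mul0e.
Qed.

End euclidean_volume.

(** * The radial majorant on one dyadic shell *)

Section radial_integral.
Context {R : realType} (d : nat).
Variables (gamma nu p : R).
Hypothesis gamma_gt0 : 0 < gamma.
Hypothesis nu_gt0 : 0 < nu.
Implicit Types (xi : 'rV[R]_d) (rho eps : R).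

Definition decay (r : R) : R := r `^ (2 * p) * expR (- nu * r `^ gamma).

Lemma decay_ge0 r : 0 <= decay r.
Proof. by rewrite mulr_ge0 ?powR_ge0 ?expR_ge0. Qed.

Lemma measurable_decay : measurable_fun [set: 'rV[R]_d] (fun xi => (decay (enorm xi))%:E).
Proof.
apply/measurable_EFinP; apply: (@measurableT_comp _ _ _ _ _ _ decay).
  apply: measurable_funM; first exact: measurable_powR.
  apply: measurableT_comp; first exact: measurable_expR.
  by apply: measurable_funM => //; exact: measurable_powR.
exact: measurable_enorm.
Qed.

(** The exponential decreases, and the power is largest at one end of the shell, depending on the
    sign of [p]; the factor [1 + 2^(2 p)] covers both cases. *)
Lemma decay_shell rho r : 0 < rho -> rho <= r < 2 * rho ->
  decay r <= (1 + 2 `^ (2 * p)) * decay rho.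
Proof.
move=> rho0 /andP[r1 r2]; have r0 := lt_le_trans rho0 r1.
rewrite /decay mulrA ler_pM ?powR_ge0 ?expR_ge0//; last first.
  rewrite ler_expR !mulNr lerN2 ler_wpM2l ?(ltW nu_gt0)//.
  by rewrite ge0_ler_powR ?nnegrE ?(ltW gamma_gt0) ?(ltW rho0) ?(ltW r0).
have [p0|p0] := leP 0 (2 * p).
  rewrite (@le_trans _ _ ((2 * rho) `^ (2 * p)))//.
    by rewrite ge0_ler_powR ?p0 ?nnegrE ?(ltW r0) ?(ltW r2)// mulr_ge0 ?(ltW rho0).
  by rewrite powRM ?(ltW rho0)// [leRHS]mulrDl mul1r lerDr powR_ge0.
rewrite (@le_trans _ _ (rho `^ (2 * p)))//; last first.
  by rewrite [leRHS]mulrDl mul1r lerDl mulr_ge0 ?powR_ge0.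
rewrite -[2 * p]opprK !(powRN _ (- (2 * p))) lef_pV2 ?posrE ?powR_gt0//.
by rewrite ge0_ler_powR ?nnegrE ?oppr_ge0 ?(ltW p0) ?(ltW rho0) ?(ltW r0).
Qed.

Definition shell rho : set 'rV[R]_d :=
  [set xi | rho <= enorm xi] `&` [set xi | enorm xi < 2 * rho].

Lemma measurable_shell rho : measurable (shell rho).
Proof.
by apply: measurableI; [exact: measurable_enorm_ge|exact: measurable_enorm_lt].
Qed.

(** The shell lies in the ball of radius [2 rho], of volume at most [(4 rho)^d], which shifts the
    exponent from [2 p] to [2 p + d]. *)
Lemma integral_shell_le rho : 0 < rho ->
  (\int[lebesgue_rV d]_(xi in shell rho) (decay (enorm xi))%:E <=
   ((1 + 2 `^ (2 * p)) * 4 ^+ d *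
     (rho `^ (2 * p + d%:R) * expR (- nu * rho `^ gamma)))%:E)%E.
Proof.
move=> rho0; set K := (1 + 2 `^ (2 * p)) * decay rho.
have K0 : 0 <= K by rewrite mulr_ge0 ?decay_ge0// addr_ge0 ?powR_ge0.
apply: (@le_trans _ _ (\int[lebesgue_rV d]_(xi in shell rho) K%:E)%E).
  apply: ge0_le_integral_nonmeasurable => xi.
    by move=> _; rewrite lee_fin decay_ge0.
  by move=> [/= r1 r2]; rewrite lee_fin decay_shell// r1.
rewrite integral_cst//; last exact: measurable_shell.
apply: (@le_trans _ _ (K%:E * ((2 * (2 * rho)) ^+ d)%:E)%E).
  rewrite lee_wpmul2l ?lee_fin//.
  apply: le_trans (lebesgue_rV_ball_le d (mulr_gt0 (ltr0n R 2) rho0)).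
  apply: le_measure; rewrite ?inE.
  - exact: measurable_shell.
  - exact: measurable_enorm_lt.
  - by move=> xi [].
rewrite -EFinM lee_fin /K /decay powRD ?(gt_eqF rho0) ?implybT//.
rewrite powR_mulrn ?(ltW rho0)//.
have -> : (2 * (2 * rho)) ^+ d = 4 ^+ d * rho ^+ d.
  by rewrite -exprMn; congr (_ ^+ d); ring.
by rewrite le_eqVlt; apply/orP; left; apply/eqP; ring.
Qed.

End radial_integral.

(** * Summation over dyadic shells *)

Section dyadic_sum.
Context {R : realType} (d : nat).
Variables (gamma nu p : R).
Hypothesis gamma_gt0 : 0 < gamma.
Hypothesis nu_gt0 : 0 < nu.
Implicit Types (xi : 'rV[R]_d) (eps : R).

(** Take the least [m] with [|xi| < 2^m eps]. It is nonzero because [eps <= |xi|], and [xi] lies in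
    the shell of index [m - 1]. *)
Lemma bigcup_shell eps : 0 < eps ->
  [set xi : 'rV[R]_d | eps <= enorm xi] = \bigcup_k @shell R d (2 ^+ k * eps).
Proof.
move=> e0; apply/seteqP; split => [xi /= exi|xi [k _ [/= H _]]]; last first.
  by rewrite /= (le_trans _ H)// ler_peMl ?(ltW e0)// exprn_ege1// ler1n.
have ex : exists n, enorm xi < 2 ^+ n * eps.
  exists (Num.bound (enorm xi / eps)).
  have : enorm xi / eps < (Num.bound (enorm xi / eps))%:R.
    by rewrite archi_boundP// divr_ge0 ?enorm_ge0// ltW.
  rewrite ltr_pdivrMr// => /lt_le_trans; apply.
  rewrite ler_wpM2r ?(ltW e0)// -natrX ler_nat ltnW//.
  exact: ltn_expl.
have := ex_minnP ex => -[m Hm minm].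
case: m Hm minm => [|k] Hm minm.
  by move: Hm; rewrite expr0 mul1r ltNge exi.
exists k => //; split => /=; last by rewrite mulrA -exprS.
rewrite leNgt; apply/negP => /minm.
by rewrite ltnn.
Qed.

Lemma trivIset_shell eps : 0 < eps ->
  trivIset [set: nat] (fun k => @shell R d (2 ^+ k * eps)).
Proof.
move=> e0; apply: ltn_trivIset => n m mn; apply/seteqP; split => // xi [[/= _ H1] [/= H2 _]].
have := lt_le_trans H1 (le_trans _ (lexx _)) => /(_ (2 ^+ n * eps)).
rewrite mulrA -exprS ler_wpM2r ?(ltW e0) ?ler_eXn2l ?ltr1n// => /(_ isT).
by rewrite ltNge H2.
Qed.

Lemma integral_decay_ge : exists2 C, 0 <= C & forall eps, 0 < eps -> eps < 1 ->
  (\int[lebesgue_rV d]_(xi in [set xi | (eps <= enorm xi)%R])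
      (decay gamma nu p (enorm xi))%:E <= (C * growth d p eps)%:E)%E.
Proof.
have [C [G [C0 G0 HG Geps]]] := decay_telescope gamma_gt0 nu_gt0 (2 * p + d%:R).
pose K := (1 + 2 `^ (2 * p)) * 4 ^+ d.
have K0 : 0 <= K by rewrite mulr_ge0 ?exprn_ge0// addr_ge0 ?powR_ge0.
exists (K * C) => [|eps e0 e1]; first by rewrite mulr_ge0.
have D0 xi : (0 <= (decay gamma nu p (enorm xi))%:E)%E by rewrite lee_fin decay_ge0.
rewrite bigcup_shell// ge0_integral_bigcup//; last 3 first.
- by move=> k; exact: measurable_shell.
- by apply: measurable_funTS; exact: measurable_decay.
- exact: trivIset_shell.
apply: lime_le.
  by apply: is_cvg_nneseries => k _ _; apply: integral_ge0.
(* The partial sums telescope, and the subtracted gauge is nonnegative, which leaves a bound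
   independent of [n]. *)
apply: nearW => n; apply: (@le_trans _ _ (K * C * (G eps - G (2 ^+ n * eps)))%:E).
  elim: n => [|n IH]; first by rewrite big_geq// expr0 mul1r subrr mulr0.
  have r0 : 0 < 2 ^+ n * eps by rewrite mulr_gt0// exprn_gt0.
  rewrite big_nat_recr//=.
  have H := le_trans (integral_shell_le d p gamma_gt0 nu_gt0 r0) _.
  apply: le_trans (leeD IH (H ((K * (C * (G (2 ^+ n * eps) - G (2 * (2 ^+ n * eps)))))%:E) _)) _.
    by rewrite lee_fin -/K ler_wpM2l// HG.
  rewrite -EFinD lee_fin exprS -[2 * 2 ^+ n * eps]mulrA.
  by rewrite le_eqVlt; apply/orP; left; apply/eqP; ring.
rewrite lee_fin ler_wpM2l ?mulr_ge0//.
rewrite (@le_trans _ _ (G eps))//.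
  by rewrite gerBl G0// mulr_gt0// exprn_gt0.
by rewrite /growth (le_trans (Geps _ e0 e1))// addr_eq0.
Qed.

Lemma growth_ge0 eps : 0 < eps -> eps < 1 -> 0 <= growth d p eps.
Proof.
move=> e0 e1; rewrite /growth !addr_ge0 ?powR_ge0// mulr_ge0// ln_ge0//.
by rewrite invf_ge1// ltW.
Qed.

Lemma growth_le2 eps : - d%:R < 2 * p -> 0 < eps -> eps < 1 -> growth d p eps <= 2.
Proof.
move=> pd e0 e1; rewrite /growth gt_eqF// mul0r addr0.
have u0 : 0 <= 2 * p + d%:R by lra.
have : eps `^ (2 * p + d%:R) <= eps `^ 0 by rewrite ger_powR// e0 ltW.
by rewrite powRr0 => ?; lra.
Qed.

(** Monotone convergence as [eps] decreases to [0]: in this range of [p] the growth factor stays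
    below [2]. *)
Lemma integral_decay_neq0 (C : R) : - d%:R < 2 * p -> 0 <= C ->
  (forall eps, 0 < eps -> eps < 1 ->
    (\int[lebesgue_rV d]_(xi in [set xi | (eps <= enorm xi)%R])
      (decay gamma nu p (enorm xi))%:E <= (C * growth d p eps)%:E)%E) ->
  (\int[lebesgue_rV d]_(xi in [set xi : 'rV[R]_d | (xi != 0)%R]) (decay gamma nu p (enorm xi))%:E
    <= (2 * C)%:E)%E.
Proof.
move=> pd C0 H.
(* Starting at [1 / 2] keeps every radius strictly below [1]. *)
pose e (n : nat) : R := n.+2%:R^-1.
have e0 n : 0 < e n by rewrite invr_gt0.
have e1 n : e n < 1 by rewrite invf_lt1 ?ltr1n.
pose F n := [set xi : 'rV[R]_d | e n <= enorm xi].
have EF : [set xi : 'rV[R]_d | xi != 0] = \bigcup_n F n.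
  apply/seteqP; split => [xi /= x0|xi [n _ /= Fn]]; last first.
    by rewrite /= -enorm_gt0 (lt_le_trans (e0 n)).
  have r0 : 0 < enorm xi by rewrite enorm_gt0.
  exists (Num.bound (enorm xi)^-1) => //=.
  rewrite /F/= /e invf_ple ?posrE//.
  have bd : (enorm xi)^-1 < (Num.bound (enorm xi)^-1)%:R.
    by rewrite archi_boundP// invr_ge0 ltW.
  by rewrite (le_trans (ltW bd))// ler_nat -addn2 leq_addr.
rewrite EF.
have cv : ((\int[lebesgue_rV d]_(xi in F n) (decay gamma nu p (enorm xi))%:E)
    @[n --> \oo] --> \int[lebesgue_rV d]_(xi in \bigcup_n F n)
      (decay gamma nu p (enorm xi))%:E)%E.
  apply: ge0_nondecreasing_set_cvg_integral => //.
  - move=> n m nm; apply/subsetPset => xi /=; apply: le_trans.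
    by rewrite lef_pV2 ?posrE// ler_nat.
  - by move=> n; exact: measurable_enorm_ge.
  - by move=> n; apply: measurable_funTS; exact: measurable_decay.
  - by move=> n xi _; rewrite lee_fin decay_ge0.
rewrite -(cvg_lim _ cv)//; apply: lime_le; first by apply/cvg_ex; eexists; exact: cv.
apply: nearW => n; apply: le_trans (H _ (e0 n) (e1 n)) _.
by rewrite lee_fin mulrC ler_wpM2r// growth_le2.
Qed.

End dyadic_sum.

(** * Integral bounds for each order of differentiation *)

Section qhat_integrals.
Context {R : realType} {d : nat}.
Variables (gamma nu : R) (a : nat) (b : R).
Hypothesis d_gt0 : (0 < d)%N.
Hypothesis gamma_gt0 : 0 < gamma.
Hypothesis nu_gt0 : 0 < nu.

Lemma qhat_integrals_le n : exists N : R, 0 <= N /\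
  forall (psi : R -> 'rV[R]_d -> R[i]) (alpha : multi_index d),
  symbol_assumptions gamma nu psi -> (mi_order alpha <= max_order d)%N ->
  mi_order alpha = n -> forall s t, s < t ->
  (forall eps, 0 < eps -> eps < 1 ->
    (\int[lebesgue_rV d]_(xi in [set xi : 'rV[R]_d | (eps <= enorm xi)%R])
        ((Normc.normc (qhat gamma psi alpha a b s t xi)) ^+ 2)%:E
     <= (N * growth d (qhat_exponent gamma a b n) eps)%:E)%E) /\
  (- d%:R < 2 * qhat_exponent gamma a b n ->
    (\int[lebesgue_rV d]_xi
        ((Normc.normc (qhat gamma psi alpha a b s t xi)) ^+ 2)%:E <= N%:E)%E).
Proof.
set p := qhat_exponent gamma a b n.
have [K K0 HK] := @sqr_qhat_le R d gamma nu a b gamma_gt0 nu_gt0 n.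
have [C C0 HC] := integral_decay_ge d p gamma_gt0 nu_gt0.
(* The factor [2] bounds the growth factor in the integral over the whole space; the truncated bound
   would hold with [K * C]. *)
exists (K * (2 * C)); split; first by rewrite !mulr_ge0.
move=> psi alpha Hpsi ha han s t st.
have q0 xi : (0 <= ((Normc.normc (qhat gamma psi alpha a b s t xi)) ^+ 2)%:E)%E.
  by rewrite lee_fin sqr_ge0.
have D0 xi : (0 <= (decay gamma nu p (@enorm R d xi))%:E)%E by rewrite lee_fin decay_ge0.
have intK D : measurable D ->
  (\int[lebesgue_rV d]_(xi in D) (K * decay gamma nu p (enorm xi))%:E =
   K%:E * \int[lebesgue_rV d]_(xi in D) (decay gamma nu p (enorm xi))%:E)%E.
  move=> mD; under eq_integral do rewrite EFinM.
  rewrite ge0_integralZl//.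
  by apply: measurable_funTS; exact: measurable_decay.
split=> [eps e0 e1|pd].
  apply: (@le_trans _ _ (\int[lebesgue_rV d]_(xi in [set xi | (eps <= enorm xi)%R])
    (K * decay gamma nu p (enorm xi))%:E)%E).
    apply: ge0_le_integral_nonmeasurable => // xi /= exi.
    by rewrite lee_fin HK// -enorm_gt0 (lt_le_trans e0).
  rewrite intK; last exact: measurable_enorm_ge.
  rewrite -[K * _ * _]mulrA EFinM lee_wpmul2l ?lee_fin//.
  apply: le_trans (HC _ e0 e1) _.
  by rewrite lee_fin ler_wpM2r ?growth_ge0// ler_peMl// ler1n.
have [m0 z0] := @lebesgue_rV_0 R d d_gt0.
(* The derivatives at the origin are junk, so the majorant is [+oo] there. *)
pose h (xi : 'rV[R]_d) : \bar R :=
  if xi == 0 then +oo%E else (K * decay gamma nu p (enorm xi))%:E.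
have mh : measurable_fun [set: 'rV[R]_d] h.
  apply: measurable_fun_ifT => //.
    apply: (@measurable_fun_bool _ _ _ _ true).
    rewrite setTI (_ : _ @^-1` _ = [set 0])//.
    by apply/seteqP; split => xi /= /eqP.
  apply/measurable_EFinP; apply: measurable_funM => //.
  by apply/measurable_EFinP; exact: measurable_decay.
have h0 xi : (0 <= h xi)%E.
  by rewrite /h; case: ifP => // _; rewrite lee_fin mulr_ge0 ?decay_ge0.
apply: (@le_trans _ _ (\int[lebesgue_rV d]_xi h xi)%E).
  apply: ge0_le_integral_nonmeasurable => // xi _.
  rewrite /h; case: ifPn => [_|x0]; first by rewrite leey.
  by rewrite lee_fin HK.
(* The origin is a null set, so the infinite value of [h] there does not contribute. *)
rewrite (ge0_negligible_integral m0)// setTD.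
have E : ~` [set 0] = [set xi : 'rV[R]_d | xi != 0].
  by apply/seteqP; split => xi /= /eqP.
rewrite (eq_integral (fun xi => (K * decay gamma nu p (enorm xi))%:E)); last first.
  by move=> xi; rewrite E inE /= /h => /negbTE ->.
rewrite intK; last exact: measurableC.
rewrite E EFinM lee_wpmul2l ?lee_fin//.
exact: integral_decay_neq0.
Qed.

End qhat_integrals.

(** * One constant for all orders of differentiation *)

Unset Implicit Arguments.

Theorem lemma3p4 (R : realType) (d : nat) (gamma nu : R) (a : nat) (b : R)
    (d_gt0 : (0 < d)%N) (gamma_gt0 : 0 < gamma) (nu_gt0 : 0 < nu) :
  exists N : R,
    forall (psi : R -> 'rV[R]_d -> complex R) (alpha : multi_index d),
      symbol_assumptions gamma nu psi ->
      (mi_order alpha <= max_order d)%N ->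
      (forall eps s t : R, 0 < eps -> eps < 1 -> s < t ->
        (\int[lebesgue_rV d]_(xi in [set xi : 'rV[R]_d | (eps <= enorm xi)%R])
            ((Normc.normc (qhat gamma psi alpha a b s t xi)) ^+ 2)%:E
         <= (N * [&& a == 0%N, b == 0 & alpha != mi0 d]%:R *
               growth d (gamma - (mi_order alpha)%:R) eps +
             N * ((a != 0%N)%:R + (b != 0)%:R + (alpha == mi0 d)%:R) *
               growth d (gamma * a%:R + b - (mi_order alpha)%:R) eps)%:E)%E) /\
      ([/\ a = 0%N, b = 0, alpha <> mi0 d &
           2 * (gamma - (mi_order alpha)%:R) > - d%:R] \/
       2 * (gamma * a%:R + b - (mi_order alpha)%:R) > - d%:R ->
       (ereal_sup [set \int[lebesgue_rV d]_xi
                         ((Normc.normc (qhat gamma psi alpha a b st.1 st.2 xi)) ^+ 2)%:E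
                   | st in [set st : R * R | (st.1 < st.2)%R]] <= N%:E)%E).
Proof.
have /choice[N HN] := @qhat_integrals_le R d gamma nu a b d_gt0 gamma_gt0 nu_gt0.
have N0 n : 0 <= N n by have [] := HN n.
(* The constants depend on [alpha] only through its order; the sum over the finitely many admissible
   orders dominates each of them. *)
exists (\sum_(n < (max_order d).+1) N n) => psi alpha Hpsi ha.
set n := mi_order alpha in ha *.
have [_ /(_ _ _ Hpsi ha erefl) Hn] := HN n.
set M := \sum_(n < _) _.
have NM : N n <= M.
  rewrite /M (bigD1 (Ordinal (ha : (n < (max_order d).+1)%N)))//= lerDl.
  by rewrite sumr_ge0.
have M0 : 0 <= M by rewrite (le_trans (N0 n)).
have En : (n != 0%N) = (alpha != mi0 d).
  by rewrite -mi_dirs_nil -size_eq0 size_mi_dirs.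
move: Hn; rewrite /qhat_exponent En => Hn.
split=> [eps s t e0 e1 st|pd].
  have [/(_ _ e0 e1) H _] := Hn _ _ st.
  apply: le_trans H _; rewrite lee_fin.
  case: ifPn => [/and3P[/eqP -> /eqP -> /negbTE ->]|c].
    by rewrite !eqxx /= !addr0 mulr0 mul0r addr0 mulr1 ler_wpM2r ?growth_ge0.
  rewrite mulr0 mul0r add0r ler_wpM2r ?growth_ge0//.
  rewrite (le_trans NM)// ler_peMr//.
  (* Outside the special case at least one of the three indicators equals [1], so their sum is at
     least [1]. *)
  by case: eqP c => _; case: eqP => _; case: eqP => _ //= _; lra.
apply: ub_ereal_sup => _ [[s t] /= st <-].
have [_ H] := Hn _ _ st.
apply: le_trans (H _) _; last by rewrite lee_fin.
(* When [a = b = 0] and [alpha] is nonzero, condition (ii) implies condition (i) because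
   [gamma > 0]. *)
case: ifPn => [/and3P[/eqP a0 /eqP b0 _]|c].
  case: pd => [[_ _ _ //]|]; rewrite a0 b0 mulr0 add0r; lra.
case: pd => // -[a0 b0 al _].
by move: c; rewrite a0 b0 !eqxx /=; move/eqP: al => ->.
Qed.
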